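(* For every integer $n\ge 1$ there is a power of two $q_{\mathrm{adj}}=q_{\mathrm{adj}}(n)<(n+2)^4$ and a literal-systematic map $$E_n^{\mathrm{adj}}:\mathbb F_{q_{\mathrm{adj}}}^n\longrightarrow\mathbb F_{q_{\mathrm{adj}}}^{n+3}$$ that corrects one adjacent burst of deletions of length zero, one, or two, where all three trailer symbols are also exposed to deletion; the family $(E_n^{\mathrm{adj}})_{n\ge1}$ is uniform, and encoding and decoding are polynomial time.
   Context: For a word $z=z_1\cdots z_L$, $1\le r\le L$ and $1\le d\le L-r+1$, the length-$r$ adjacent (burst) deletion beginning at $d$ is $\mathsf B_{r,d}(z)=z_1\cdots z_{d-1}z_{d+r}\cdots z_L$; the length-$0$ burst leaves $z$ unchanged. A fixed-length code corrects one burst of length at most two if, for every fixed $r\in\{0,1,2\}$, distinct codewords have disjoint sets of length-$r$ burst descendants. A map corrects such bursts if its image, with distinct messages giving distinct codewords, does. An encoder $E:\mathcal A^n\to\mathcal A^{n+r}$ is literal-systematic if $E(x)=x\,\Vert\,p(x)$ (concatenation) for some map $p:\mathcal A^n\to\mathcal A^r$; the burst may hit any of the $n+r$ coordinates. Uniformity: a family of encoders and decoders (over alphabets $\mathcal A_n$ that may vary with $n$) is uniform if one pair of deterministic algorithms, given $n$ and the relevant input word, constructs all $n$-dependent auxiliary data (field models, orders, etc.) and evaluates the encoder, respectively the decoder, in time polynomial in $n$ and $\log|\mathcal A_n|$; no advice string or table depending on $n$ is supplied. *)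

(* Defs.v *)
From HB Require Import structures.
From mathcomp Require Import all_boot all_order all_algebra all_field.

Set Implicit Arguments.
Unset Strict Implicit.
Unset Printing Implicit Defensive.

Import GRing.Theory.

(** * Burst deletions *)

Section Burst.
Variable T : eqType.
Implicit Types (z w : seq T).

(* The position d is 1-based: z_1 .. z_(d-1) z_(d+r) .. z_L. *)
Definition burst_del (r d : nat) z : seq T := take d.-1 z ++ drop (d.-1 + r) z.

Definition burst_descendant (r : nat) z w : Prop :=
  if r is 0 then w = z
  else r <= size z /\ exists2 d, 1 <= d <= size z - r + 1 & w = burst_del r d z.

(* The disjointness is required for each fixed r; descendants of two codewords
   under bursts of different lengths have different sizes. *)
Definition code_corrects_burst2 (C : seq T -> Prop) : Prop :=
  forall r, r <= 2 -> forall c c', C c -> C c' -> c <> c' ->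
  forall w, ~ (burst_descendant r c w /\ burst_descendant r c' w).

End Burst.

Section Maps.
Variables (A : eqType) (n r : nat).
Implicit Types (E : n.-tuple A -> (n + r).-tuple A).

Definition corrects_burst2 E : Prop :=
  injective E /\
  code_corrects_burst2 (fun c : seq A => exists x, c = E x).

Definition literal_systematic E : Prop :=
  exists p : n.-tuple A -> r.-tuple A, forall x, E x = x ++ p x :> seq A.

Definition decodes_burst2 E (D : seq A -> n.-tuple A) : Prop :=
  forall b, b <= 2 -> forall (x : n.-tuple A) (y : seq A),
    burst_descendant b (E x) y -> D y = x.

End Maps.

(** * A model of deterministic computation

    Programs of a one-variable WHILE language whose store is a binary tree
    (Jones, Computability and Complexity, 1997).  Every construct is charged
    the size of the current store, i.e. the cost of reading or copying it, so
    that running time agrees with Turing-machine time up to a polynomial even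
    though [Pair] duplicates the store (see [runs_size]). *)

Inductive tree : Type := Leaf | Node of tree & tree.

Fixpoint tsize (x : tree) : nat :=
  if x is Node l r then (tsize l + tsize r).+1 else 1.

Definition left_sub (x : tree) := if x is Node l _ then l else Leaf.
Definition right_sub (x : tree) := if x is Node _ r then r else Leaf.

Inductive prog : Type :=
  | Id
  | Nil
  | Hd
  | Tl
  | Pair of prog & prog
  | Seq of prog & prog
  | If of prog & prog & prog
  | While of prog & prog.

(* [runs p x y t]: started on x, the program p halts with y in time t.
   In tests, [Leaf] means false and any [Node] means true. *)
Inductive runs : prog -> tree -> tree -> nat -> Prop :=
  | RId x : runs Id x x (tsize x)
  | RNil x : runs Nil x Leaf (tsize x)
  | RHd x : runs Hd x (left_sub x) (tsize x)
  | RTl x : runs Tl x (right_sub x) (tsize x)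
  | RPair p q x y z s t :
      runs p x y s -> runs q x z t ->
      runs (Pair p q) x (Node y z) (tsize x + s + t)
  | RSeq p q x y z s t :
      runs p x y s -> runs q y z t ->
      runs (Seq p q) x z (tsize x + s + t)
  | RIfT b p q x l r y s t :
      runs b x (Node l r) s -> runs p x y t ->
      runs (If b p q) x y (tsize x + s + t)
  | RIfF b p q x y s t :
      runs b x Leaf s -> runs q x y t ->
      runs (If b p q) x y (tsize x + s + t)
  | RWhileT b p x l r y z s t u :
      runs b x (Node l r) s -> runs p x y t -> runs (While b p) y z u ->
      runs (While b p) x z (tsize x + s + t + u)
  | RWhileF b p x s :
      runs b x Leaf s ->
      runs (While b p) x x (tsize x + s).

Lemma tsize_gt0 x : 0 < tsize x.
Proof. by case: x. Qed.

Lemma runs_det p x y t : runs p x y t ->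
  forall y' t', runs p x y' t' -> y = y' /\ t = t'.
Proof.
elim=> {p x y t} *;
  match goal with H : runs _ _ _ _ |- _ = ?y' /\ _ => 
    match type of H with runs _ _ y' _ => inversion H; subst end end;
  repeat match goal with
    IH : forall y t, runs ?p ?x y t -> _, H : runs ?p ?x _ _ |- _ =>
      let e := fresh in have [e ?] := IH _ _ H; clear H;
      first [discriminate e | subst]
    end; by [].
Qed.

Lemma runs_size p x y t : runs p x y t -> tsize y <= t.
Proof.
elim=> {p x y t} //=.
- by move=> x; apply: tsize_gt0.
- by case=> //= l r; rewrite leqW // leq_addr.
- by case=> //= l r; rewrite leqW // leq_addl.
- move=> p q x y z s t _ ys _ zt.
  by rewrite -add1n -addnA leq_add ?tsize_gt0 // leq_add.
- by move=> p q x y z s t _ _ _ zt; rewrite (leq_trans zt) ?leq_addl.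
- by move=> b p q x l r y s t _ _ _ yt; rewrite (leq_trans yt) ?leq_addl.
- by move=> b p q x y s t _ _ _ yt; rewrite (leq_trans yt) ?leq_addl.
- by move=> b p x l r y z s t u _ _ _ _ _ zu; rewrite (leq_trans zu) ?leq_addl.
- by move=> b p x s _ _; rewrite leq_addr.
Qed.

Definition runs_within (p : prog) (x y : tree) (T : nat) : Prop :=
  exists2 t, runs p x y t & t <= T.

(** * Binary field models *)

(* F_2[X]/(f) with f monic irreducible, elements being the polynomials of
   degree less than deg f. *)
Record field_model := FieldModel {
  modulus : {poly 'F_2};
  modulusP : monic_irreducible_poly modulus }.

Definition model_field (M : field_model) : finFieldType :=
  {poly %/ modulus M with modulusP M}.

(** * Representation of the data as trees *)

Definition enc_seq (s : seq tree) : tree := foldr Node Leaf s.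

(* Unary; since all time bounds are polynomial in n itself, nothing would
   change with binary. *)
Definition enc_nat (n : nat) : tree := enc_seq (nseq n Leaf).

Definition enc_bit (a : 'F_2) : tree :=
  if a == 0%R then Leaf else Node Leaf Leaf.

(* Coefficients of 1, X, .., X^(k-1), in this order. *)
Definition enc_poly (k : nat) (f : {poly 'F_2}) : tree :=
  enc_seq [seq enc_bit (f`_i)%R | i <- iota 0 k].

Definition enc_model (M : field_model) : tree :=
  enc_poly (size (modulus M)) (modulus M).

(* An element is its word of deg f coefficients. *)
Definition enc_elt (M : field_model) (a : model_field M) : tree :=
  enc_poly (size (modulus M)).-1 (val a).

Definition enc_word (M : field_model) (w : seq (model_field M)) : tree :=
  enc_seq [seq enc_elt a | a <- w].

(** * Uniform polynomial-time families *)

(* The programs and the exponents are chosen before n, and the programs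
   receive only n and the input word.  [Pmodel] constructs the field model in
   which the symbols read and written by [Penc] and [Pdec] are expressed.  The
   decoder is run on every word whose length is that of a codeword hit by a
   burst of length at most two, descendant of a codeword or not. *)
Definition uniform_poly_time (r : nat) (M : nat -> field_model)
    (E : forall n, n.-tuple (model_field (M n)) ->
                   (n + r).-tuple (model_field (M n)))
    (D : forall n, seq (model_field (M n)) -> n.-tuple (model_field (M n))) :
    Prop :=
  exists (Pmodel Penc Pdec : prog) (c k : nat), forall n, 1 <= n ->
  let T := c * (n + trunc_log 2 #|model_field (M n)|) ^ k in
  [/\ runs_within Pmodel (enc_nat n) (enc_model (M n)) T,
      forall x : n.-tuple (model_field (M n)),
        runs_within Penc (Node (enc_nat n) (enc_word x)) (enc_word (E n x)) T
    & forall y : seq (model_field (M n)), n + r - 2 <= size y <= n + r ->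
        runs_within Pdec (Node (enc_nat n) (enc_word y)) (enc_word (D n y)) T].

(* Main.v *)
(* The redundancy of x consists of three symbols o, e, h.  The symbols o and e
   make both parity classes of v = x o e sum to zero, so that the values of the
   deleted symbols are known; h carries the major indices (Tenengolts'
   signature) of v and of its two parity classes modulo their lengths, which
   locates a single deletion in v, respectively in each class when two adjacent
   symbols are lost.  Tenengolts' argument is that moving a letter a across a
   block Q changes the major index by k d1 + des(aQa) - (k + |Q| + 1) d2 with
   d1, d2 in {0, 1}, which is nonzero modulo the length unless Q is a power of a.
   A burst reaching h is harmless provided that h occurs in v only as e: about
   n^3 / 4 signatures with n + 2 representatives each leave room for that in an
   alphabet of at least (n + 2)^4 / 2 symbols.

   As the alphabet has polynomial size, the decoder may try all insertions and
   the field model may be found by exhaustive search.  Polynomial time is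
   established through the closure of the class of polynomial-time functions
   under composition, pairing, tests and polynomially bounded folds. *)

Require Import Defs.
From HB Require Import structures.
From mathcomp Require Import all_boot all_order all_algebra all_field.
From mathcomp Require Import fingroup cyclic zify.
Import Defs.

Set Implicit Arguments.
Unset Strict Implicit.
Unset Printing Implicit Defensive.

(** * Polynomial-time functions *)

(** The encoder is written once, over any type with an addition, a zero and a numbering [rank],
    [unrank]. Over the field it is open to arguments about sums; over lists of bits it is a function
    on trees, for which programs can be built; [encode_map] identifies the two.

    If h survives in both codewords, both have the same signature and [maj_move] applies. The
    obstacle is a burst that takes h from only one of them, since no signatures can then be
    compared. The zero sums remain: they show that the h of the other codeword equals a symbol
    deleted from it, which its choice excludes except at e. At e the remaining symbols already give
    equal messages, so e may be exempted; this leaves n + 1 symbols to avoid, fewer than the n + 2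
    representatives.

    For running times the obstacle is that a fold of a polynomial-time step may double its
    accumulator at each turn. Hence the closure lemmas for folds and iterations ask for a bound on
    intermediate values, and the list of all words is governed by a unary bound on its length, not
    by the number of bits. *)

Structure encType := EncType { enc_sort :> Type; enc : enc_sort -> tree }.

(** The encodings agree where conversions should be free: false is [Leaf], as the tests of programs
    expect, a nonempty list is the pair of its head and tail, and a number is a list of units. *)
Canonical unit_encType := @EncType unit (fun=> Leaf).
Canonical bool_encType :=
  @EncType bool (fun b => if b then Node Leaf Leaf else Leaf).
Canonical nat_encType := @EncType nat enc_nat.
Canonical seq_encType (A : encType) :=
  @EncType (seq A) (fun s => enc_seq [seq enc a | a <- s]).
Canonical prod_encType (A B : encType) :=
  @EncType (A * B) (fun x => Node (enc x.1) (enc x.2)).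

Definition esize (A : encType) (x : A) : nat := tsize (enc x).

Section EncodingSize.
Variables A B : encType.

Lemma esize_cons (a : A) t : esize (a :: t) = (esize a + esize t).+1.
Proof. by []. Qed.

Lemma esize_pair (b : B) (a : A) : esize (b, a) = (esize b + esize a).+1.
Proof. by []. Qed.

Lemma size_esize (t : seq A) : size t < esize t.
Proof.
elim: t => //= a t IH; rewrite esize_cons ltnS (leq_trans IH) //.
by rewrite leq_addl.
Qed.

End EncodingSize.

Lemma runs_within_le p x y T T' :
  runs_within p x y T -> T <= T' -> runs_within p x y T'.
Proof. by case=> t rt le_tT le_TT'; exists t => //; apply: leq_trans le_TT'. Qed.

Section Polynomial.
Variables A : encType.

(** The base is at least 2, so constants, sums and products are absorbed by the exponent and a
    single number stands for a polynomial. *)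
Definition poly_bounded (g : A -> nat) : Prop :=
  exists k, forall x, g x <= (esize x).+1 ^ k.

Lemma esizeS_gt1 (x : A) : 1 < (esize x).+1.
Proof. by rewrite ltnS tsize_gt0. Qed.

Lemma poly_bounded_le g h :
  (forall x, g x <= h x) -> poly_bounded h -> poly_bounded g.
Proof. by move=> gh [k hk]; exists k => x; apply: leq_trans (gh x) (hk x). Qed.

Lemma poly_bounded_esize : poly_bounded (fun x => esize x).
Proof. by exists 1 => x; rewrite expn1. Qed.

Lemma poly_bounded_cst c : poly_bounded (fun=> c).
Proof.
exists c => x; apply: leq_trans (ltnW (ltn_expl c (ltnSn 1))) _.
by case: c => [|c]; rewrite ?expn0 // leq_exp2r // esizeS_gt1.
Qed.

Lemma poly_boundedM g h :
  poly_bounded g -> poly_bounded h -> poly_bounded (fun x => g x * h x).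
Proof. by move=> [k gk] [l hl]; exists (k + l) => x; rewrite expnD leq_mul. Qed.

Lemma poly_boundedD g h :
  poly_bounded g -> poly_bounded h -> poly_bounded (fun x => g x + h x).
Proof.
move=> [k gk] [l hl]; exists (k + l).+1 => x.
have lt1 := esizeS_gt1 x.
rewrite expnS (leq_trans (leq_add (gk x) (hl x))) //.
rewrite (leq_trans _ (leq_mul lt1 (leqnn _))) // mul2n -addnn.
by rewrite leq_add // leq_exp2l // ?leq_addr ?leq_addl.
Qed.

Lemma poly_boundedS g : poly_bounded g -> poly_bounded (fun x => (g x).+1).
Proof.
move=> gP; apply: poly_bounded_le (poly_boundedD gP (poly_bounded_cst 1)) => x.
by rewrite addn1.
Qed.

Lemma poly_boundedX g k : poly_bounded g -> poly_bounded (fun x => g x ^ k).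
Proof.
move=> gP; elim: k => [|k IH]; first exact: poly_bounded_cst.
by apply: poly_bounded_le (poly_boundedM gP IH) => x; rewrite expnS.
Qed.

End Polynomial.
Arguments poly_bounded_esize {A}.
Arguments poly_bounded_cst {A}.

Definition ptime (A B : encType) (f : A -> B) : Prop :=
  exists p k, forall x,
    runs_within p (enc x) (enc (f x)) ((esize x).+1 ^ k).

Lemma ptimeI (A B : encType) (f : A -> B) p g :
  poly_bounded g -> (forall x, runs_within p (enc x) (enc (f x)) (g x)) ->
  ptime f.
Proof.
by move=> [k gk] run_p; exists p, k => x; apply: runs_within_le (run_p x) (gk x).
Qed.

Section Ptime.
Variables A B : encType.
Implicit Types f : A -> B.

Lemma ptimeE f : ptime f -> exists p g,
  poly_bounded g /\ forall x, runs_within p (enc x) (enc (f x)) (g x).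
Proof.
case=> p [k run_p]; exists p, (fun x => (esize x).+1 ^ k); split=> //.
exact/poly_boundedX/poly_boundedS/poly_bounded_esize.
Qed.

End Ptime.

Section PtimeClosure.
Variables A B C : encType.
Implicit Types f : A -> B.

Lemma eq_ptime f f' : f =1 f' -> ptime f -> ptime f'.
Proof. by move=> eqf [p [k run_p]]; exists p, k => x; rewrite -eqf. Qed.

(** A result is never larger than the time spent on it, by [runs_size]. This controls the input of
    the second program in a composition. *)
Lemma ptime_esize f : ptime f -> poly_bounded (fun x => esize (f x)).
Proof.
case=> p [k run_p]; exists k => x.
by have [t run_t] := run_p x; apply: leq_trans; apply: runs_size run_t.
Qed.

Lemma ptime_comp f (g : B -> C) : ptime f -> ptime g -> ptime (fun x => g (f x)).
Proof.
move=> fP gP; have [p [F [FP run_p]]] := ptimeE fP.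
case: gP => q [k run_q].
apply: (@ptimeI _ _ _ (Seq p q)
  (fun x => esize x + F x + (esize (f x)).+1 ^ k)); last first.
  move=> x; have [s rs les] := run_p x; have [t rt let_] := run_q (f x).
  by exists (esize x + s + t); [apply: RSeq rs rt | rewrite !leq_add].
apply: poly_boundedD; first exact: poly_boundedD poly_bounded_esize FP.
exact/poly_boundedX/poly_boundedS/ptime_esize.
Qed.

Lemma ptime_pair f (g : A -> C) : ptime f -> ptime g -> ptime (fun x => (f x, g x)).
Proof.
move=> /ptimeE[p [F [FP run_p]]] /ptimeE[q [G [GP run_q]]].
apply: (@ptimeI _ _ _ (Pair p q) (fun x => esize x + F x + G x)).
  exact: poly_boundedD (poly_boundedD poly_bounded_esize FP) GP.
move=> x; have [s rs les] := run_p x; have [t rt let_] := run_q x.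
by exists (esize x + s + t); [apply: RPair | rewrite !leq_add].
Qed.

Lemma ptime_if (b : A -> bool) f f' : ptime b -> ptime f -> ptime f' ->
  ptime (fun x => if b x then f x else f' x).
Proof.
move=> /ptimeE[p [F [FP run_p]]] /ptimeE[q [G [GP run_q]]].
move=> /ptimeE[r [H [HP run_r]]].
apply: (@ptimeI _ _ _ (If p q r) (fun x => esize x + F x + (G x + H x))).
  apply: poly_boundedD (poly_boundedD GP HP).
  exact/poly_boundedD/FP/poly_bounded_esize.
move=> x; have [s rs les] := run_p x.
case: (b x) rs => rs.
  have [t rt let_] := run_q x; exists (esize x + s + t).
    exact: RIfT rs rt.
  by rewrite leq_add // ?leq_add // (leq_trans let_) ?leq_addr.
have [t rt let_] := run_r x; exists (esize x + s + t).
  exact: RIfF rs rt.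
by rewrite leq_add // ?leq_add // (leq_trans let_) ?leq_addl.
Qed.

Lemma ptime_prog p f : (forall x, runs p (enc x) (enc (f x)) (esize x)) -> ptime f.
Proof.
move=> run_p; apply: (@ptimeI _ _ _ p _ poly_bounded_esize) => x.
by exists (esize x).
Qed.

(** For changes of type that leave the tree as it is, such as reading a pair as a nonempty list. *)
Lemma ptime_cast (f : A -> B) (g : B -> C) :
  (forall y, enc (g y) = enc y) -> ptime f -> ptime (fun x => g (f x)).
Proof.
move=> gE [p [k run_p]]; exists p, k => x.
by rewrite gE.
Qed.

End PtimeClosure.

Section PtimeBasic.
Variables A B C : encType.

Lemma ptime_id : ptime (fun x : A => x).
Proof. by apply: (@ptime_prog _ _ Id) => x; apply: RId. Qed.

Lemma ptime_cst (c : B) : ptime (fun _ : A => c).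
Proof.
suff [p [F [FP run_p]]] : exists p F, @poly_bounded A F /\
    forall x, runs_within p (enc x) (enc c) (F x).
  exact: ptimeI FP run_p.
elim: (enc c) => [|l [p [F [FP run_p]]] r [q [G [GP run_q]]]].
  exists Nil, (fun x : A => esize x); split; first exact: poly_bounded_esize.
  by move=> x; exists (esize x) => //; apply: RNil.
exists (Pair p q), (fun x : A => esize x + F x + G x); split.
  exact: poly_boundedD (poly_boundedD poly_bounded_esize FP) GP.
move=> x; have [s rs les] := run_p x; have [t rt let_] := run_q x.
by exists (esize x + s + t); [apply: RPair | rewrite !leq_add].
Qed.

Lemma ptime_fst (f : A -> B * C) : ptime f -> ptime (fun x => (f x).1).
Proof.
move=> fP; apply: (ptime_comp fP).
by apply: (@ptime_prog _ _ Hd) => x; apply: RHd.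
Qed.

Lemma ptime_snd (f : A -> B * C) : ptime f -> ptime (fun x => (f x).2).
Proof.
move=> fP; apply: (ptime_comp fP).
by apply: (@ptime_prog _ _ Tl) => x; apply: RTl.
Qed.

Lemma ptime_cons (f : A -> B) (s : A -> seq B) :
  ptime f -> ptime s -> ptime (fun x => f x :: s x).
Proof.
move=> fP sP; apply: (ptime_cast _ (ptime_pair fP sP) (g := fun p => p.1 :: p.2)).
by [].
Qed.

Lemma ptime_behead (s : A -> seq B) : ptime s -> ptime (fun x => behead (s x)).
Proof.
move=> sP; apply: (ptime_comp sP).
by apply: (@ptime_prog _ _ Tl) => -[|b t]; apply: RTl.
Qed.

Lemma ptime_nilp (s : A -> seq B) : ptime s -> ptime (fun x => nilp (s x)).
Proof.
move=> sP; apply: (ptime_comp sP).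
have run1 (x : tree) : runs_within (If Id Nil (Pair Nil Nil)) x
    (if x is Leaf then Node Leaf Leaf else Leaf) (tsize x + tsize x + 3 * tsize x).
  case: x => [|l r]; last first.
    eexists; first by apply: RIfT (RId _) (RNil _).
    by rewrite leq_add2l mulSn leq_addr.
  by eexists; first exact: RIfF (RId _) (RPair (RNil _) (RNil _)).
apply: (@ptimeI _ _ _ (If Id Nil (Pair Nil Nil))
  (fun x => esize x + esize x + 3 * esize x)); last first.
  by move=> x; have := run1 (enc x); case: x.
have idP := @poly_bounded_esize (seq_encType B).
exact: poly_boundedD (poly_boundedD idP idP) (poly_boundedM (poly_bounded_cst 3) idP).
Qed.

(** [Hd] alone would answer [Leaf] on the empty list, hence the test that selects the default. *)
Lemma ptime_head (b : A -> B) (s : A -> seq B) :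
  ptime b -> ptime s -> ptime (fun x => head (b x) (s x)).
Proof.
move=> bP sP.
have [p [F [FP run_p]]] := ptimeE (ptime_nilp sP).
have [q [G [GP run_q]]] := ptimeE bP.
have [r [H [HP run_r]]] := ptimeE sP.
apply: (@ptimeI _ _ _ (If p q (Seq r Hd))
   (fun x => esize x + F x + (G x + (esize x + H x + esize (s x))))).
  have idP := @poly_bounded_esize A.
  exact: (poly_boundedD (poly_boundedD idP FP)
    (poly_boundedD GP (poly_boundedD (poly_boundedD idP HP) (ptime_esize sP)))).
move=> x; have [u ru leu] := run_p x.
have [v rv lev] := run_q x; have [w rw lew] := run_r x.
rewrite /esize; case: (s x) ru rw => [|a t] ru rw.
  exists (tsize (enc x) + u + v); first exact: RIfT ru rv.
  by rewrite leq_add ?leq_add // (leq_trans lev) ?leq_addr.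
exists (tsize (enc x) + u + (tsize (enc x) + w + tsize (enc (a :: t)))).
  by apply: RIfF ru _; apply: RSeq rw _; apply: RHd.
apply: leq_add; first exact: leq_add.
by apply: leq_trans (leq_addl _ _); rewrite !leq_add.
Qed.

End PtimeBasic.
Arguments ptime_id {A}.
Arguments ptime_cst {A B}.

Lemma leq_exp2r_homo m n k : m <= n -> m ^ k <= n ^ k.
Proof. by case: k => // k le_mn; rewrite leq_exp2r. Qed.

Section Fold.
Variables C B A : encType.
Variables (F : C -> B -> A -> B) (z : C -> B) (s : C -> seq A).

(** The store holds the parameter, the accumulator and the remaining list, in this order; [test]
    reads the list, which is a [Node] as long as it is nonempty. *)
Let test := Seq Tl Tl.
Let body p := Pair Hd (Pair (Seq (Pair Hd (Pair (Seq Tl Hd) (Seq Tl (Seq Tl Hd)))) p)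
  (Seq Tl (Seq Tl Tl))).

(** All components of the store stay below [M], so a turn costs one call of [p] and a bounded number
    of visits to the store; the factor 100 is a generous allowance for these. *)
Lemma loop_run (p : prog) (c : C) (G M : nat) :
    (forall b a, esize b <= M -> esize a <= M ->
       runs_within p (enc (c, (b, a))) (enc (F c b a)) G) ->
    esize c <= M ->
    forall t b, esize t <= M ->
    (forall i, esize (foldl (F c) b (take i t)) <= M) ->
  runs_within (While test (body p)) (enc (c, (b, t)))
    (enc (c, (foldl (F c) b t, [::] : seq A)))
    ((size t).+1 * (G + 100 * M.+1)).
Proof.
move=> run_p cM; elim=> [|a t IH] b tM bM.
  have := bM 0; rewrite take0 /= => {}bM; rewrite mul1n.
  eexists.
    apply: (@RWhileF test (body p) (enc (c, (b, [::] : seq A)))).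
    exact: (RSeq (RTl (enc (c, (b, [::] : seq A)))) (RTl (enc (b, [::] : seq A)))).
  rewrite /=; move: cM bM tM; rewrite /esize /=.
  lia.
have bM0 := bM 0; rewrite take0 /= in bM0.
have aM : esize a <= M by move: tM; rewrite esize_cons; lia.
have {}tM : esize t <= M by move: tM; rewrite esize_cons; lia.
have [u ru leu] := run_p b a bM0 aM.
have [v rv lev] := IH (F c b a) tM (fun i => bM i.+1).
eexists.
  apply: RWhileT; first exact: RSeq (RTl _) (RTl _).
    apply: RPair (RHd _) _.
    apply: RPair; last exact: RSeq (RTl _) (RSeq (RTl _) (RTl _)).
    apply: RSeq ru.
    exact: RPair (RHd _) (RPair (RSeq (RTl _) (RHd _))
      (RSeq (RTl _) (RSeq (RTl _) (RHd _)))).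
  exact: rv.
rewrite [(size (a :: t)).+1 * _]mulSn leq_add //.
rewrite /esize in cM aM tM bM0; rewrite /=; set k := tsize (enc_seq _).
have {}tM : k <= M := tM.
lia.
Qed.

(** Bounded recursion in the manner of Cobham: [g] bounds every partial result, which rules out
    exponential growth by repeated doubling. *)
Lemma ptime_foldl_bounded (g : C -> nat) :
    ptime (fun p : C * (B * A) => F p.1 p.2.1 p.2.2) -> ptime z -> ptime s ->
    poly_bounded g ->
    (forall c i, esize (foldl (F c) (z c) (take i (s c))) <= g c) ->
  ptime (fun c => foldl (F c) (z c) (s c)).
Proof.
move=> [p [k run_p]] zP sP gP gB.
pose M c := esize c + esize (s c) + g c.
have MP : poly_bounded M.
  exact: poly_boundedD (poly_boundedD poly_bounded_esize (ptime_esize sP)) gP.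
have initP : ptime (fun c => (c, (z c, s c))).
  exact: ptime_pair ptime_id (ptime_pair zP sP).
have loopP : ptime (fun c => (c, (foldl (F c) (z c) (s c), [::] : seq A))).
  have [q [Q [QP run_q]]] := ptimeE initP.
  (* The step reads [(c, (b, a))]: three components of size at most [M c] and two pairing nodes. The
     third unit comes from the definition of [ptime]. *)
  pose G c := (3 * M c).+3 ^ k.
  apply: (@ptimeI _ _ _ (Seq q (While test (body p)))
     (fun c => esize c + Q c + (M c).+1 * (G c + 100 * (M c).+1))).
    have M1P := poly_boundedS MP.
    have GP : poly_bounded G.
      apply: poly_boundedX; do 3!apply: poly_boundedS.
      exact: (poly_boundedM (poly_bounded_cst 3) MP).
    apply: poly_boundedD; first exact: poly_boundedD poly_bounded_esize QP.
    apply: (poly_boundedM M1P (poly_boundedD GP _)).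
    exact: (poly_boundedM (poly_bounded_cst 100) M1P).
  move=> c; have [t rt let_] := run_q c.
  have [||||u ru leu] := @loop_run p c (G c) (M c) _ _ (s c) (z c).
  - move=> b a bM aM; apply: runs_within_le (run_p (c, (b, a))) _.
    apply: leq_exp2r_homo; rewrite !esize_pair.
    by rewrite /M in bM aM *; lia.
  - by rewrite /M; lia.
  - by rewrite /M; lia.
  - by move=> i; apply: leq_trans (gB c i) _; rewrite /M; lia.
  eexists; first exact: RSeq rt ru.
  rewrite leq_add // ?leq_add //; apply: leq_trans leu _.
  rewrite leq_mul // ltnS /M.
  by apply: leq_trans (ltnW (size_esize _)) _; lia.
have := ptime_snd loopP => /ptime_fst.
exact.
Qed.

End Fold.

Section FoldClosure.
Variables C B A : encType.

Lemma esize_mem (t : seq A) i : i < size t ->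
  forall a, esize (nth a t i) <= esize t.
Proof.
elim: t i => [|b t IH] [|i] //= it a; rewrite esize_cons; first by lia.
by have := IH i it a; lia.
Qed.

Lemma ptime_esize_bound (G : C -> A -> B) (s : C -> seq A) :
    ptime (fun p : C * A => G p.1 p.2) -> ptime s ->
  exists g, poly_bounded g /\
    forall c a, esize a <= esize (s c) -> esize (G c a) <= g c.
Proof.
move=> /ptime_esize[k Gk] sP.
exists (fun c => (esize c + esize (s c)).+2 ^ k); split.
  apply: poly_boundedX; do 2!apply: poly_boundedS.
  exact: (poly_boundedD poly_bounded_esize (ptime_esize sP)).
move=> c a le_as; apply: leq_trans (Gk (c, a)) _.
by apply: leq_exp2r_homo; rewrite esize_pair; lia.
Qed.

Variables (F : C -> B -> A -> B) (z : C -> B) (s : C -> seq A).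

(** A local criterion: if each turn adds at most [g c] to the accumulator, its size stays below the
    initial one plus [g c] times the length of the list. *)
Lemma ptime_foldl (g : C -> nat) :
    ptime (fun p : C * (B * A) => F p.1 p.2.1 p.2.2) -> ptime z -> ptime s ->
    poly_bounded g ->
    (forall c b a, esize a <= esize (s c) -> esize (F c b a) <= esize b + g c) ->
  ptime (fun c => foldl (F c) (z c) (s c)).
Proof.
move=> FP zP sP gP gB.
apply: (@ptime_foldl_bounded _ _ _ _ _ _ (fun c => esize (z c) + esize (s c) * g c)) => //.
  apply: poly_boundedD; first exact: ptime_esize.
  exact: (poly_boundedM (ptime_esize sP) gP).
move=> c i; set t := take i _.
have szt : size t <= esize (s c).
  apply: leq_trans (ltnW (size_esize (s c))).
  by rewrite size_take; case: ltnP => // /ltnW.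
have : forall j, j < size t -> forall a, esize (nth a t j) <= esize (s c).
  move=> j jt a; rewrite nth_take; last first.
    by apply: leq_trans jt _; rewrite size_take; case: ltnP.
  apply: esize_mem; apply: leq_trans jt _.
  by rewrite size_take; case: ltnP => // /ltnW.
suff IH u b : (forall j, j < size u -> forall a, esize (nth a u j) <= esize (s c)) ->
    esize (foldl (F c) b u) <= esize b + size u * g c.
  move=> tB; apply: leq_trans (IH t (z c) tB) _.
  by rewrite leq_add2l leq_mul2r szt orbT.
elim: u b => [|a u IHu] b bu /=; first by rewrite addn0.
apply: leq_trans (IHu _ _) _; first by move=> j ju; apply: (bu j.+1).
have := gB c b a (bu 0 isT a); rewrite mulSn; lia.
Qed.

End FoldClosure.

Section Foldr.
Variables C B A : encType.

Lemma ptime_catrev (s t : C -> seq A) :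
  ptime s -> ptime t -> ptime (fun c => catrev (s c) (t c)).
Proof.
move=> sP tP.
apply: (@eq_ptime _ _ (fun c => foldl (fun acc a => a :: acc) (t c) (s c))).
  by move=> c; elim: (s c) (t c) => //= a u IH v; rewrite IH.
apply: (@ptime_foldl _ _ _ _ _ _ (fun c => (esize (s c)).+1)) => //.
- apply: ptime_cons; first exact/ptime_snd/ptime_snd/ptime_id.
  exact/ptime_fst/ptime_snd/ptime_id.
- exact/poly_boundedS/ptime_esize.
- by move=> c b a le_a; rewrite esize_cons; lia.
Qed.

Lemma ptime_rev (s : C -> seq A) : ptime s -> ptime (fun c => rev (s c)).
Proof. by move=> sP; apply: ptime_catrev sP (ptime_cst _). Qed.

Lemma ptime_cat (s t : C -> seq A) :
  ptime s -> ptime t -> ptime (fun c => s c ++ t c).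
Proof.
move=> sP tP; apply: (@eq_ptime _ _ (fun c => catrev (rev (s c)) (t c))).
  by move=> c; rewrite catrevE revK.
exact: ptime_catrev (ptime_rev sP) tP.
Qed.

Lemma esize_rev (t : seq A) : esize (rev t) = esize t.
Proof.
(* Generalised to [catrev]: the two lists share one final leaf, hence the predecessor. *)
rewrite /rev -[RHS](addn0 (esize t)) -[0]/(esize ([::] : seq A)).-1.
elim: t [::] => [|a t IH] u /=; first by rewrite add1n prednK ?tsize_gt0.
by rewrite IH !esize_cons /=; have : 0 < esize u := tsize_gt0 _; lia.
Qed.

Lemma ptime_foldr (F : C -> A -> B -> B) (z : C -> B) (s : C -> seq A)
    (g : C -> nat) :
    ptime (fun p : C * (B * A) => F p.1 p.2.2 p.2.1) -> ptime z -> ptime s ->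
    poly_bounded g ->
    (forall c b a, esize a <= esize (s c) -> esize (F c a b) <= esize b + g c) ->
  ptime (fun c => foldr (F c) (z c) (s c)).
Proof.
move=> FP zP sP gP gB.
apply: (@eq_ptime _ _ (fun c => foldl (fun b a => F c a b) (z c) (rev (s c)))).
  by move=> c; rewrite foldl_rev.
apply: (@ptime_foldl _ _ _ _ _ _ g) => //; first exact: ptime_rev.
by move=> c b a; rewrite esize_rev; apply: gB.
Qed.

End Foldr.

Ltac ptime_step := first
  [ exact: ptime_id | exact: ptime_cst | assumption
  | apply: ptime_fst | apply: ptime_snd ].

Section ListClosure.
Variables C B A : encType.

Lemma ptime_map (F : C -> A -> B) (s : C -> seq A) :
  ptime (fun p : C * A => F p.1 p.2) -> ptime s ->
  ptime (fun c => [seq F c a | a <- s c]).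
Proof.
move=> FP sP; have [g [gP gB]] := ptime_esize_bound FP sP.
apply: (@eq_ptime _ _ (fun c => foldr (fun a t => F c a :: t) [::] (s c))).
  by move=> c; elim: (s c) => //= a t ->.
apply: (@ptime_foldr _ _ _ (fun c a t => F c a :: t) _ _ (fun c => (g c).+1)) => //.
- apply: ptime_cons; last by repeat ptime_step.
  apply: (ptime_comp (f := fun p : C * (seq B * A) => (p.1, p.2.2)) _ FP).
  by apply: ptime_pair; repeat ptime_step.
- exact: ptime_cst.
- exact: poly_boundedS.
- by move=> c b a /gB; rewrite esize_cons; lia.
Qed.

Lemma ptime_filter (F : C -> A -> bool) (s : C -> seq A) :
  ptime (fun p : C * A => F p.1 p.2) -> ptime s ->
  ptime (fun c => [seq a <- s c | F c a]).
Proof.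
move=> FP sP.
apply: (@ptime_foldr _ _ _ (fun c a t => if F c a then a :: t else t) _ _
  (fun c => (esize (s c)).+1)) => //.
- apply: ptime_if; last by repeat ptime_step.
    apply: (ptime_comp (f := fun p : C * (seq A * A) => (p.1, p.2.2)) _ FP).
    by apply: ptime_pair; repeat ptime_step.
  by apply: ptime_cons; repeat ptime_step.
- exact: ptime_cst.
- exact/poly_boundedS/ptime_esize.
- by move=> c b a; case: ifP => _; rewrite ?esize_cons; lia.
Qed.

Lemma esize_cat (s t : seq A) : esize (s ++ t) <= esize s + esize t.
Proof.
elim: s => [|a s IH] /=; first exact: leq_addl.
by rewrite !esize_cons; lia.
Qed.

Lemma ptime_flatten (s : C -> seq (seq A)) :
  ptime s -> ptime (fun c => flatten (s c)).
Proof.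
move=> sP.
apply: (@ptime_foldr _ _ _ (fun c a t => a ++ t) _ _ (fun c => esize (s c))) => //.
- by apply: ptime_cat; repeat ptime_step.
- exact: ptime_cst.
- exact: ptime_esize.
- by move=> c b a le_a; apply: leq_trans (esize_cat _ _) _; rewrite addnC leq_add2l.
Qed.

End ListClosure.

(** * Boolean connectives and equality tests *)

Lemma ptime_negb (C : encType) (b : C -> bool) : ptime b -> ptime (fun c => ~~ b c).
Proof.
by move=> bP; apply: (ptime_if bP (ptime_cst false) (ptime_cst true)).
Qed.

Lemma ptime_andb (C : encType) (b b' : C -> bool) :
  ptime b -> ptime b' -> ptime (fun c => b c && b' c).
Proof. by move=> bP b'P; apply: (ptime_if bP b'P (ptime_cst false)). Qed.

Lemma ptime_addb (C : encType) (b b' : C -> bool) :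
  ptime b -> ptime b' -> ptime (fun c => b c (+) b' c).
Proof.
move=> bP b'P; apply: eq_ptime (ptime_if bP (ptime_negb b'P) b'P) => c.
by case: (b c).
Qed.

Lemma ptime_eqb (C : encType) (b b' : C -> bool) :
  ptime b -> ptime b' -> ptime (fun c => b c == b' c).
Proof.
move=> bP b'P; apply: eq_ptime (ptime_negb (ptime_addb bP b'P)) => c.
by case: (b c) (b' c) => [] [].
Qed.

Section EqClosure.
Variables C A : encType.

Lemma ptime_all2 (r : A -> A -> bool) (s t : C -> seq A) :
  ptime (fun p : A * A => r p.1 p.2) -> ptime s -> ptime t ->
  ptime (fun c => all2 r (s c) (t c)).
Proof.
move=> rP sP tP.
(* The second list travels in the accumulator next to a flag of success. The default [a] of [head]
   is guarded by the test for emptiness. *)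
pose step (st : bool * seq A) a :=
  (if st.1 && ~~ nilp st.2 then r a (head a st.2) else false, behead st.2).
pose state c := foldl step (true, t c) (s c).
have stateP : ptime state.
  apply: (@ptime_foldl _ _ _ (fun=> step) _ _ (fun=> 3)) => //.
  - apply: ptime_pair; last by apply: ptime_behead; repeat ptime_step.
    apply: ptime_if; last exact: ptime_cst.
      apply: ptime_andb; first by repeat ptime_step.
      by apply/ptime_negb/ptime_nilp; repeat ptime_step.
    apply: (ptime_comp (f := fun p : C * (bool * seq A * A) =>
      (p.2.2, head p.2.2 p.2.1.2)) _ rP).
    by apply: ptime_pair; [|apply: ptime_head]; repeat ptime_step.
  - by apply: ptime_pair => //; apply: ptime_cst.
  - exact: poly_bounded_cst.
  - move=> c [ok u] a _; rewrite /step !esize_pair /=.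
    have bb (b : bool) : esize b <= 3 by case: b.
    have : esize (behead u) <= esize u by case: u => //= ??; rewrite esize_cons; lia.
    have := bb (if ok && ~~ nilp u then r a (head a u) else false).
    have : 0 < esize ok := tsize_gt0 _; lia.
apply: (@eq_ptime _ _ (fun c => (state c).1 && nilp (state c).2)).
  move=> c; rewrite /state.
  have stF u v : (foldl step (false, u) v).1 = false.
    by elim: v u => //= a v IH u; rewrite /step IH.
  elim: (s c) (t c) => [|a u IH] [|b v] //=; first by rewrite /step /= stF.
  rewrite /step /= -/step; case: (r a b) => /=; first exact: IH.
  by rewrite stF.
by apply: ptime_andb; [|apply: ptime_nilp]; repeat ptime_step.
Qed.

End EqClosure.

Lemma ptime_eq_bits (C : encType) (s t : C -> seq bool) :
  ptime s -> ptime t -> ptime (fun c => s c == t c).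
Proof.
move=> sP tP; apply: (@eq_ptime _ _ (fun c => all2 eq_op (s c) (t c))).
  by move=> c; rewrite eqseq_all.
by apply: ptime_all2 sP tP; apply: ptime_eqb; repeat ptime_step.
Qed.

Lemma ptime_eq_words (C : encType) (s t : C -> seq (seq bool)) :
  ptime s -> ptime t -> ptime (fun c => s c == t c).
Proof.
move=> sP tP; apply: (@eq_ptime _ _ (fun c => all2 eq_op (s c) (t c))).
  by move=> c; rewrite eqseq_all.
by apply: ptime_all2 sP tP; apply: ptime_eq_bits; repeat ptime_step.
Qed.

(** * Arithmetic on unary numbers *)

Lemma esizeS n : esize n.+1 = (esize n).+2.
Proof. by []. Qed.

Lemma esize_nat n : esize n = n.*2.+1.
Proof. by elim: n => // n IH; rewrite esizeS IH. Qed.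

Lemma ptime_succ (C : encType) (n : C -> nat) : ptime n -> ptime (fun c => (n c).+1).
Proof. by move=> nP; apply: (ptime_cast _ (ptime_pair (ptime_cst tt) nP)
  (g := fun p => p.2.+1)). Qed.

Lemma ptime_pred (C : encType) (n : C -> nat) : ptime n -> ptime (fun c => (n c).-1).
Proof.
move=> nP; apply: (ptime_comp nP).
by apply: (@ptime_prog _ _ Tl) => -[|k]; apply: RTl.
Qed.

(** A unary number is, as a tree, a list of units; through this view folds over lists become counted
    loops. *)
Lemma ptime_nseq (C : encType) (n : C -> nat) : ptime n -> ptime (fun c => nseq (n c) tt).
Proof.
by move=> nP; apply: (ptime_cast _ nP (g := nseq^~ tt)) => k; rewrite /= map_nseq.
Qed.

Lemma ptime_eq0 (C : encType) (n : C -> nat) : ptime n -> ptime (fun c => n c == 0).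
Proof.
move=> nP; apply: eq_ptime (ptime_nilp (ptime_nseq nP)) => c.
by rewrite /nilp size_nseq.
Qed.

Lemma esize_seq_le (A : encType) (s : seq A) M :
  (forall i, i < size s -> forall a, esize (nth a s i) <= M) ->
  esize s <= size s * M.+1 + 1.
Proof.
elim: s => [|a s IH] sM //=; rewrite esize_cons.
have := IH (fun i => sM i.+1); have := sM 0 isT a; rewrite /= mulSn; lia.
Qed.

Section IterClosure.
Variables C B : encType.
Variables (n : C -> nat) (F : C -> B -> B) (z : C -> B).

Lemma foldl_nseq_iter T (f : T -> T) x k :
  foldl (fun y _ => f y) x (nseq k tt) = iter k f x.
Proof. by elim: k x => //= k IH x; rewrite IH -iterSr. Qed.

Lemma ptime_iter_bounded (g : C -> nat) :
    ptime n -> ptime (fun p : C * B => F p.1 p.2) -> ptime z -> poly_bounded g ->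
    (forall c i, i <= n c -> esize (iter i (F c) (z c)) <= g c) ->
  ptime (fun c => iter (n c) (F c) (z c)).
Proof.
move=> nP FP zP gP gB.
apply: (@eq_ptime _ _ (fun c => foldl (fun y _ => F c y) (z c) (nseq (n c) tt))).
  by move=> c; rewrite foldl_nseq_iter.
apply: (@ptime_foldl_bounded _ _ _ (fun c y _ => F c y) _ _ g) => //.
- apply: (ptime_comp (f := fun p : C * (B * unit) => (p.1, p.2.1)) _ FP).
  by apply: ptime_pair; repeat ptime_step.
- exact: ptime_nseq.
move=> c i; have -> : take i (nseq (n c) tt) = nseq (minn i (n c)) tt.
  by elim: (n c) i => [|k IH] [|i] //=; rewrite IH minnSS.
by rewrite foldl_nseq_iter gB // geq_minr.
Qed.

Lemma ptime_iter (g : C -> nat) :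
    ptime n -> ptime (fun p : C * B => F p.1 p.2) -> ptime z -> poly_bounded g ->
    (forall c b, esize (F c b) <= esize b + g c) ->
  ptime (fun c => iter (n c) (F c) (z c)).
Proof.
move=> nP FP zP gP gB.
apply: (@ptime_iter_bounded (fun c => esize (z c) + esize (n c) * g c)) => //.
  apply: poly_boundedD; first exact: ptime_esize.
  exact: (poly_boundedM (ptime_esize nP) gP).
move=> c i le_in; apply: (@leq_trans (esize (z c) + i * g c)).
  elim: i {le_in} => [|i IH] /=; first by rewrite addn0.
  by apply: leq_trans (gB _ _) _; rewrite mulSn; lia.
by rewrite leq_add2l leq_mul2r esize_nat; apply/orP; right; lia.
Qed.

End IterClosure.

Lemma ptime_addn (C : encType) (m n : C -> nat) :
  ptime m -> ptime n -> ptime (fun c => m c + n c).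
Proof.
move=> mP nP; apply: (@eq_ptime _ _ (fun c => iter (m c) succn (n c))).
  by move=> c; rewrite iter_succn addnC.
apply: (@ptime_iter _ _ _ (fun=> succn) _ (fun=> 2)) => //.
- by apply: ptime_succ; repeat ptime_step.
- exact: poly_bounded_cst.
- by move=> c b; rewrite esizeS addn2.
Qed.

Lemma ptime_muln (C : encType) (m n : C -> nat) :
  ptime m -> ptime n -> ptime (fun c => m c * n c).
Proof.
move=> mP nP; apply: (@eq_ptime _ _ (fun c => iter (m c) (addn (n c)) 0)).
  by move=> c; rewrite iter_addn_0 mulnC.
apply: (@ptime_iter _ _ _ (fun c => addn (n c)) _ (fun c => esize (n c))) => //.
- apply: ptime_addn; last by repeat ptime_step.
  by apply: (ptime_comp (f := fst) _ nP); repeat ptime_step.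
- exact: ptime_cst.
- exact: ptime_esize.
- by move=> c b; rewrite !esize_nat; lia.
Qed.

Lemma ptime_subn (C : encType) (m n : C -> nat) :
  ptime m -> ptime n -> ptime (fun c => m c - n c).
Proof.
move=> mP nP; apply: (@eq_ptime _ _ (fun c => iter (n c) predn (m c))).
  by move=> c; rewrite iter_predn.
apply: (@ptime_iter _ _ _ (fun=> predn) _ (fun=> 0)) => //.
- by apply: ptime_pred; repeat ptime_step.
- exact: poly_bounded_cst.
- by move=> c b; rewrite !esize_nat; lia.
Qed.

Lemma ptime_leq (C : encType) (m n : C -> nat) :
  ptime m -> ptime n -> ptime (fun c => m c <= n c).
Proof. by move=> mP nP; apply: ptime_eq0; apply: ptime_subn. Qed.

Lemma ptime_eqn (C : encType) (m n : C -> nat) :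
  ptime m -> ptime n -> ptime (fun c => m c == n c).
Proof.
move=> mP nP; apply: (@eq_ptime _ _ (fun c => (m c <= n c) && (n c <= m c))).
  by move=> c; rewrite eqn_leq.
by apply: ptime_andb; apply: ptime_leq.
Qed.

Lemma ptime_modn (C : encType) (m n : C -> nat) :
  ptime m -> ptime n -> ptime (fun c => m c %% n c).
Proof.
move=> mP nP.
(* Counting up to [m c] with a reset at [n c]. For [n c = 0] the reset never happens, in agreement
   with [modn0]. *)
apply: (@eq_ptime _ _ (fun c =>
    iter (m c) (fun r => if r.+1 == n c then 0 else r.+1) 0)).
  move=> c; elim: (m c) => [|k IH] /=; first by rewrite mod0n.
  case: (posnP (n c)) IH => [-> /= |n_gt0] ->; first by rewrite !modn0.
  have ltm := ltn_pmod k n_gt0.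
  case: eqP => [e|/eqP ne]; first by rewrite -addn1 -modnDml addn1 e modnn.
  have lt1 : (k %% n c).+1 < n c by rewrite ltn_neqAle; apply/andP.
  by rewrite -[in RHS]addn1 -modnDml addn1 (modn_small lt1).
apply: (@ptime_iter _ _ _ (fun c r => if r.+1 == n c then 0 else r.+1) _
  (fun=> 2)) => //.
- apply: ptime_if; last 1 first.
  + by apply: ptime_succ; repeat ptime_step.
  + apply: ptime_eqn; first by apply: ptime_succ; repeat ptime_step.
    by apply: (ptime_comp (f := fst) _ nP); repeat ptime_step.
  + exact: ptime_cst.
- exact: ptime_cst.
- exact: poly_bounded_cst.
- by move=> c b; case: ifP => _; rewrite !esize_nat; lia.
Qed.

Lemma ptime_iota (C : encType) (n : C -> nat) : ptime n -> ptime (fun c => iota 0 (n c)).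
Proof.
move=> nP.
have iotaE i : iter i (fun t : seq nat => t ++ [:: size t]) [::] = iota 0 i.
  by elim: i => //= i ->; rewrite size_iota -[[:: i]]/(iota i 1) -iotaD addn1.
apply: (@eq_ptime _ _ _ _ (fun c => iotaE (n c))).
apply: (@ptime_iter_bounded _ _ _ (fun _ t => t ++ [:: size t]) _
  (fun c => esize (n c) * (esize (n c)).+1 + 1)) => //.
- apply: ptime_cat; first by repeat ptime_step.
  apply: ptime_cons; last exact: ptime_cst.
  apply: (@eq_ptime _ _ (fun p : C * seq nat => foldl (fun k _ => k.+1) 0 p.2)).
    move=> [c t] /=; rewrite -[RHS]add0n; elim: t 0 => [|a t IH] k /=.
      by rewrite addn0.
    by rewrite IH addSnnS.
  apply: (@ptime_foldl _ _ _ (fun _ k _ => k.+1) _ _ (fun=> 2)) => //.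
  + by apply: ptime_succ; repeat ptime_step.
  + exact: ptime_cst.
  + by repeat ptime_step.
  + exact: poly_bounded_cst.
  + by move=> c' b a _; rewrite esizeS addn2.
- exact: ptime_cst.
- have nB := ptime_esize nP; apply: poly_boundedD (poly_bounded_cst 1).
  exact: (poly_boundedM nB (poly_boundedS nB)).
move=> c i le_in; rewrite iotaE.
apply: leq_trans (esize_seq_le (M := esize (n c)) _) _.
  move=> j; rewrite size_iota => lt_ji a.
  by rewrite nth_iota // add0n !esize_nat; lia.
by rewrite size_iota leq_add2r leq_mul2r esize_nat; apply/orP; right; lia.
Qed.

Lemma ptime_sumn (C : encType) (s : C -> seq nat) : ptime s -> ptime (fun c => sumn (s c)).
Proof.
move=> sP; apply: (@ptime_foldr _ _ _ (fun=> addn) _ _ (fun c => esize (s c))) => //.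
- by apply: ptime_addn; repeat ptime_step.
- exact: ptime_cst.
- exact: ptime_esize.
- by move=> c b a le_a; move: le_a; rewrite !esize_nat; lia.
Qed.

Section Access.
Variables C A : encType.
Implicit Types (s : C -> seq A) (n : C -> nat) (x : C -> A).

Lemma ptime_size s : ptime s -> ptime (fun c => size (s c)).
Proof.
move=> sP; apply: (@ptime_foldr _ _ _ (fun _ _ k => k.+1) _ _ (fun=> 2)) => //.
- by apply: ptime_succ; repeat ptime_step.
- exact: ptime_cst.
- exact: poly_bounded_cst.
- by move=> c b a _; rewrite esizeS addn2.
Qed.

Lemma ptime_drop n s : ptime n -> ptime s -> ptime (fun c => drop (n c) (s c)).
Proof.
move=> nP sP; apply: (@eq_ptime _ _ (fun c => iter (n c) behead (s c))).
  move=> c; elim: (n c) (s c) => [|k IH] t; first by rewrite drop0.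
  by rewrite iterSr IH; case: t.
apply: (@ptime_iter _ _ _ (fun=> behead) _ (fun=> 0)) => //.
- by apply: ptime_behead; repeat ptime_step.
- exact: poly_bounded_cst.
- by move=> c [|a t] //=; rewrite esize_cons; lia.
Qed.

Lemma ptime_take n s : ptime n -> ptime s -> ptime (fun c => take (n c) (s c)).
Proof.
move=> nP sP.
apply: (@eq_ptime _ _ (fun c => rev (drop (size (s c) - n c) (rev (s c))))).
  by move=> c; rewrite -[in RHS](revK (s c)) take_rev size_rev.
apply/ptime_rev/ptime_drop; last exact: ptime_rev.
by apply: ptime_subn => //; apply: ptime_size.
Qed.

Lemma ptime_nth x n s : ptime x -> ptime n -> ptime s ->
  ptime (fun c => nth (x c) (s c) (n c)).
Proof.
move=> xP nP sP; apply: (@eq_ptime _ _ (fun c => head (x c) (drop (n c) (s c)))).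
  by move=> c; rewrite -nth0 nth_drop addn0.
exact/ptime_head/ptime_drop.
Qed.

Lemma ptime_allpairs (B D : encType) (F : C -> A -> B -> D) s (t : C -> A -> seq B) :
  ptime (fun p : C * A * B => F p.1.1 p.1.2 p.2) -> ptime s ->
  ptime (fun p : C * A => t p.1 p.2) ->
  ptime (fun c => [seq F c a b | a <- s c, b <- t c a]).
Proof.
move=> FP sP tP; apply: ptime_flatten; apply: ptime_map => //.
exact: (@ptime_map _ _ _ (fun p : C * A => F p.1 p.2)).
Qed.

End Access.

Section WordLists.
Variable C : encType.

Lemma ptime_index (w : C -> seq bool) (s : C -> seq (seq bool)) :
  ptime w -> ptime s -> ptime (fun c => index (w c) (s c)).
Proof.
move=> wP sP.
apply: (@eq_ptime _ _ (fun c =>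
    foldr (fun a k => if a == w c then 0 else k.+1) 0 (s c))).
  by move=> c; elim: (s c) => //= a t ->.
apply: (@ptime_foldr _ nat_encType (seq_encType bool_encType)
  (fun c a k => if a == w c then 0 else k.+1) _ _ (fun=> 2)) => //.
- apply: ptime_if; last 1 first.
  + by apply: ptime_succ; repeat ptime_step.
  + apply: ptime_eq_bits; first by repeat ptime_step.
    by apply: (ptime_comp (f := fst) _ wP); repeat ptime_step.
  + exact: ptime_cst.
- exact: ptime_cst.
- exact: poly_bounded_cst.
- by move=> c b a _; case: ifP => _; rewrite !esize_nat; lia.
Qed.

Lemma ptime_mem (w : C -> seq bool) (s : C -> seq (seq bool)) :
  ptime w -> ptime s -> ptime (fun c => w c \in s c).
Proof.
move=> wP sP; apply: (@eq_ptime _ _ (fun c => index (w c) (s c) < size (s c))).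
  by move=> c; rewrite index_mem.
by apply: ptime_leq; [apply/ptime_succ/ptime_index|apply: ptime_size].
Qed.

End WordLists.

(** * Major index and deletions *)

Section Parity.
Variable T : Type.
Implicit Types s t : seq T.

(** Prepending a letter exchanges the two classes, so one right fold computes both. Positions start
    at 0. *)
Definition unzip_parity s : seq T * seq T :=
  foldr (fun a p => (a :: p.2, p.1)) ([::], [::]) s.
Definition evens s := (unzip_parity s).1.
Definition odds s := (unzip_parity s).2.

Lemma evens_cons a s : evens (a :: s) = a :: odds s. Proof. by []. Qed.
Lemma odds_cons a s : odds (a :: s) = evens s. Proof. by []. Qed.

Lemma evens_odds_cat s t :
  evens (s ++ t) = evens s ++ (if odd (size s) then odds t else evens t) /\
  odds (s ++ t) = odds s ++ (if odd (size s) then evens t else odds t).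
Proof.
elim: s => // a s [IHe IHo]; rewrite cat_cons !evens_cons !odds_cons IHe IHo /=.
by case: (odd _).
Qed.

Lemma evens_cat s t :
  evens (s ++ t) = evens s ++ (if odd (size s) then odds t else evens t).
Proof. by case: (evens_odds_cat s t). Qed.

Lemma odds_cat s t :
  odds (s ++ t) = odds s ++ (if odd (size s) then evens t else odds t).
Proof. by case: (evens_odds_cat s t). Qed.

Lemma size_evens_odds s :
  size (evens s) = uphalf (size s) /\ size (odds s) = (size s)./2.
Proof.
by elim: s => // a s [IHe IHo]; rewrite evens_cons odds_cons /= IHe IHo.
Qed.

Lemma evens_odds_inj s t : evens s = evens t -> odds s = odds t -> s = t.
Proof.
elim: s t => [|a s IH] [|b t] //; rewrite !evens_cons !odds_cons.
by case=> -> eo ee; rewrite (IH t).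
Qed.

End Parity.

Lemma evens_map T T' (f : T -> T') s : evens (map f s) = map f (evens s).
Proof.
suff [] : evens (map f s) = map f (evens s) /\ odds (map f s) = map f (odds s) by [].
by elim: s => // a s [IHe IHo]; rewrite map_cons !evens_cons !odds_cons IHe IHo.
Qed.

Lemma odds_map T T' (f : T -> T') s : odds (map f s) = map f (odds s).
Proof. by case: s => // a s; rewrite /= !odds_cons evens_map. Qed.

(* The major index, with a virtual letter 0 at the end of the word. *)
Fixpoint maj_from k (s : seq nat) : nat :=
  if s is a :: t then (head 0 t < a) * k.+1 + maj_from k.+1 t else 0.

Definition maj s := maj_from 0 s.

(** These are the descents of [x :: s], without the virtual final letter used by [maj]. *)
Fixpoint descents x (s : seq nat) : nat :=
  if s is y :: t then (y < x) + descents y t else 0.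

Lemma descents_le x s : descents x s <= size s.
Proof. by elim: s x => //= y s IH x; have := IH y; case: ltnP => _ /=; lia. Qed.

(** Without descents the word is weakly increasing. For [x = y] its letters are squeezed to a single
    value. *)
Lemma descents_eq0 x s y : descents x (rcons s y) = 0 ->
  x <= y /\ all (fun u => x <= u <= y) s.
Proof.
elim: s x => [|u s IH] x /=; first by case: ltnP; lia.
case: ltnP => //= le_xu; rewrite add0n => /IH[le_uy /allP alls].
split; first exact: leq_trans le_uy.
rewrite le_uy; apply/allP => w /alls /andP[le_uw ->].
by rewrite (leq_trans le_xu).
Qed.

(** Here every step is a descent. For [x = y] this is absurd, which excludes the maximal count in
    [maj_move]. *)
Lemma descents_max x s y : descents x (rcons s y) = (size s).+1 -> y < x.
Proof.
elim: s x => [|u s IH] x /=; first by case: ltnP.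
have := descents_le u (rcons s y); rewrite size_rcons.
case: ltnP => /= [lt_ux _|_]; last by lia.
by rewrite add1n => -[/IH lt_yu]; apply: ltn_trans lt_yu lt_ux.
Qed.

Lemma descents_rcons x s y :
  descents x (rcons s y) = descents x s + (y < last x s).
Proof. by elim: s x => [|u s IH] x /=; rewrite ?addn0 // IH addnA. Qed.

(** A letter put in front of the block instead of behind it moves each inner descent of the block by
    one place, whence [descents q Q]; the other terms are the descents at the right end. All terms
    are positive because subtraction on [nat] truncates. *)
Lemma maj_from_shift k a q Q S :
  maj_from k.+1 (q :: Q ++ S)
    + (k + (size Q).+2) * ((a < last q Q) + (head 0 S < a)) =
  maj_from k (q :: Q ++ a :: S) + descents q Q + (a < last q Q)
    + (k + (size Q).+2) * (head 0 S < last q Q).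
Proof.
elim: Q q k => [|q' Q IH] q k.
  rewrite /= addn0; case: (head 0 S < q); case: (a < q); case: (head 0 S < a) => /=; lia.
have := IH q' k.+1; rewrite /=.
have -> : k.+1 + (size Q).+2 = k + (size Q).+3 by lia.
set X := (k + _) * _; set Y := (k + _) * _.
by case: (q' < q) => /=; lia.
Qed.

(* d1 and d2 tell whether inserting the letter a at its old, respectively new,
   place creates a descent. *)
Lemma maj_from_move k P a q Q S : exists d1 d2 : bool,
  maj_from k (P ++ a :: q :: Q ++ S)
    + (k + size P + (size Q).+2) * d2 =
  maj_from k (P ++ q :: Q ++ a :: S) + (k + size P) * d1
    + descents a (rcons (q :: Q) a).
Proof.
(* Inserting a letter between two neighbours never destroys a descent and creates at most one, so
   the difference is a boolean. The cases left to [lia] contradict transitivity. *)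
have [d2 d2E] : exists d2 : bool,
    d2 + (head 0 S < last q Q) = (a < last q Q) + (head 0 S < a).
  case: (ltnP (head 0 S) (last q Q)) (ltnP a (last q Q)) (ltnP (head 0 S) a).
    by move=> h1 [h2|h2] [h3|h3]; [exists true|exists false|exists false|lia].
  by move=> h1 [h2|h2] [h3|h3]; [lia|exists true|exists true|exists false].
have base j : maj_from j (a :: q :: Q ++ S) + (j + (size Q).+2) * d2 =
    maj_from j (q :: Q ++ a :: S) + j * (q < a) + descents a (rcons (q :: Q) a).
  have := maj_from_shift j a q Q S; rewrite -d2E mulnDr addnA => /addIn.
  rewrite descents_rcons /=.
  by case: (q < a) => /=; lia.
elim: P k => [|p P IH] k.
  by exists (q < a), d2; rewrite !addn0; apply: base.
(* Only the last letter of [P] sees whether [a] or [q] comes next. For a longer [P] the first letter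
   contributes equally to both sides. *)
case: P IH => [|p' P] IH; last first.
  have [d1 [d2' E]] := IH k.+1; exists d1, d2'; move: E => /=.
  have -> : k + (size P).+2 = k.+1 + (size P).+1 by lia.
  by lia.
have [d1 d1E] : exists d1 : bool, d1 + (q < p) = (a < p) + (q < a).
  case: (ltnP q p) (ltnP a p) (ltnP q a).
    by move=> h1 [h2|h2] [h3|h3]; [exists true|exists false|exists false|lia].
  by move=> h1 [h2|h2] [h3|h3]; [lia|exists true|exists true|exists false].
exists d1, d2; have := base k.+1; rewrite /= addn1.
have -> : k.+1 * d1 = k.+1 * (a < p) + k.+1 * (q < a) - k.+1 * (q < p).
  by rewrite -mulnDr -d1E mulnDr addnK.
have : k.+1 * (q < p) <= k.+1 * (a < p) + k.+1 * (q < a).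
  by rewrite -mulnDr -d1E mulnDr leq_addl.
rewrite ![_ * k.+1]mulnC; lia.
Qed.

(** Let D be the number of descents of aQa. If D = 0, then Q is a power of a. Otherwise 1 <= D <=
    |Q|, since |Q| + 1 descents would give a < a. Then |P| d1 + D - (|P| + |Q| + 1) d2 is at least 1
    for d2 = 0 and at most -1 for d2 = 1, and at most |P| + |Q| < M in absolute value, so it is
    nonzero modulo M. *)
Lemma maj_move P a Q S M : size P + size Q + size S < M ->
  maj (P ++ a :: Q ++ S) = maj (P ++ Q ++ a :: S) %[mod M] ->
  Q = nseq (size Q) a.
Proof.
case: Q => // q Q /= leM eqmaj.
have [d1 [d2]] := maj_from_move 0 P a q Q S.
set D := descents _ _; rewrite add0n => eqD.
have [D0|D_gt0] := posnP D.
  have [_ /allP alla] := descents_eq0 D0.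
  suff /all_pred1P : all (pred1 a) (q :: Q) by [].
  by apply/allP => u /alla /andP[le1 le2]; rewrite /= eqn_leq le1 le2.
have leD : D <= (size Q).+1.
  have := descents_le a (rcons (q :: Q) a); rewrite -/D size_rcons /=.
  rewrite leq_eqVlt => /orP[/eqP/descents_max|]; [by rewrite ltnn|by []].
exfalso; move: eqmaj eqD; rewrite /maj.
set v := maj_from _ _; set v' := maj_from _ _ => eqmaj eqD.
have : (size P + (size Q).+2) * d2 = size P * d1 + D %[mod M].
  apply/eqP; rewrite -(eqn_modDl v) eqD -addnA -modnDml -eqmaj modnDml.
  exact: eqxx.
move: leM; case: d2 {eqD} => /=; rewrite ?muln1 ?muln0 => leM.
  move/esym/eqP; rewrite eq_sym eqn_mod_dvd; last by case: d1 => /=; lia.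
  by move/dvdn_leq => H; have := H _; case: d1 {H} => /=; lia.
move/esym/eqP; rewrite mod0n -/(dvdn _ _) => /dvdn_leq H.
by have := H _; case: d1 {H} => /=; lia.
Qed.

(** * Recovering a word from a deletion, its sums and its major indices *)

Section Code.
Import GRing.Theory.
Local Open Scope ring_scope.
Variables (A : zmodType) (rank : A -> nat).
Hypothesis rank_inj : injective rank.
Implicit Types (s t u w v : seq A).

Local Notation sum s := (\sum_(x <- s) x).

(** Levi's lemma for words. *)
Lemma cat_eq_cat (T : Type) (u w u' w' : seq T) :
  (size u <= size u')%N -> u ++ w = u' ++ w' ->
  exists2 Q, u' = u ++ Q & w = Q ++ w'.
Proof.
elim: u u' => [|a u IH] [|a' u'] //=; [by exists [::]|by exists (a' :: u')|].
by move=> /IH{}IH [-> /IH[Q -> ->]]; exists Q.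
Qed.

(** Cancelling the common letters in the equal sums gives [a = a']. The two words then differ by the
    move of [a] across a block [Q], which is a power of [a] by [maj_move]. *)
Lemma single_deletion M u a w u' a' w' :
    let s := u ++ a :: w in let s' := u' ++ a' :: w' in
    (size s <= M)%N -> u ++ w = u' ++ w' -> sum s = sum s' ->
    maj (map rank s) = maj (map rank s') %[mod M] ->
  s = s'.
Proof.
wlog le_uu : u a w u' a' w' / (size u <= size u')%N.
  move=> wl s s' leM eqw eqsum eqmaj.
  have eqsz : size s = size s'.
    by rewrite !size_cat /= !addnS -!size_cat eqw.
  have /orP[le_uu|le_uu] := leq_total (size u) (size u'); first exact: wl.
  by apply/esym/wl => //; rewrite -eqsz.
move=> s s' leM eqw eqsum eqmaj.
have [Q eu ew] := cat_eq_cat le_uu eqw.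
have eqa : a = a'.
  move: eqsum; rewrite /s /s' eu ew -!catA !big_cat /= !big_cons !big_cat /=.
  by rewrite [X in _ + X = _]addrCA => /addrI/addrI/addIr.
move: eqmaj; rewrite /s /s' eu ew -eqa -catA !map_cat /= !map_cat /=.
move=> /maj_move; rewrite !size_map => eqQ.
have {}eqQ : map rank Q = nseq (size Q) (rank a).
  by apply: eqQ; move: leM; rewrite /s ew !size_cat /= size_cat; lia.
congr (_ ++ _); have -> : Q = nseq (size Q) a.
  by apply: (inj_map rank_inj); rewrite map_nseq.
by elim: (size Q) => //= k ->.
Qed.

(** Adjacent letters lie in different parity classes, so each class loses exactly one letter and
    [single_deletion] applies to it, whatever the parities of the two positions. The modulus only
    has to reach the length of the longer class. *)
Lemma burst2_deletion M u a b w u' a' b' w' :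
    let s := u ++ [:: a, b & w] in let s' := u' ++ [:: a', b' & w'] in
    (uphalf (size s) <= M)%N -> u ++ w = u' ++ w' ->
    sum (evens s) = sum (evens s') -> sum (odds s) = sum (odds s') ->
    maj (map rank (evens s)) = maj (map rank (evens s')) %[mod M] ->
    maj (map rank (odds s)) = maj (map rank (odds s')) %[mod M] ->
  s = s'.
Proof.
move=> s s' leM eqw sume sumo maje majo.
have [sz_e sz_o] := size_evens_odds s.
have leMe : (size (evens s) <= M)%N by rewrite sz_e.
have leMo : (size (odds s) <= M)%N by rewrite sz_o; lia.
have eqe := evens_cat u w; have eqo := odds_cat u w.
rewrite eqw evens_cat in eqe; rewrite eqw odds_cat in eqo.
move: sume sumo maje majo leMe leMo; rewrite /s /s'.
rewrite !evens_cat !odds_cat !evens_cons !odds_cons.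
move=> sume sumo maje majo leMe leMo; apply: evens_odds_inj.
  rewrite !evens_cat !evens_cons !odds_cons.
  move: eqe sume maje leMe.
  by case: (odd (size u)); case: (odd (size u')) => /esym eqe sume maje leMe;
    apply: (@single_deletion M).
rewrite !odds_cat !evens_cons !odds_cons.
move: eqo sumo majo leMo.
by case: (odd (size u)); case: (odd (size u')) => /esym eqo sumo majo leMo;
  apply: (@single_deletion M).
Qed.

End Code.

(** * The code *)

(** The three residues as digits of one number in mixed radix. The odd class may be one letter
    shorter but shares the modulus of the even one. *)
Definition syndrome (r : seq nat) : nat :=
  maj r %% size r + size r *
    (maj (evens r) %% size (evens r) +
     size (evens r) * (maj (odds r) %% size (evens r))).

Definition syndrome_bound (r : seq nat) : nat :=
  size r * (size (evens r) * size (evens r)).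

Lemma ltn_mixed_radix a b m n : a < m -> b < n -> a + m * b < m * n.
Proof.
move=> am bn; apply: leq_trans (_ : m + m * b <= _); first by rewrite ltn_add2r.
by rewrite -mulnS leq_mul2l bn orbT.
Qed.

Lemma mixed_radix_inj a b a' b' m : a < m -> a' < m ->
  a + m * b = a' + m * b' -> a = a' /\ b = b'.
Proof.
move=> am a'm E; have m_gt0 : 0 < m by case: m am {E a'm}.
split.
  have := congr1 (modn^~ m) E; rewrite /= ![m * _]mulnC !(addnC _ (_ * m)).
  by rewrite !modnMDl !modn_small.
have := congr1 (divn^~ m) E; rewrite /= ![m * _]mulnC !(addnC _ (_ * m)).
by rewrite !divnMDl // !divn_small // !addn0.
Qed.

Section SyndromeTheory.
Implicit Types r : seq nat.

Let size_evens_gt0 r : 0 < size r -> 0 < size (evens r).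
Proof. by case: (size_evens_odds r) => -> _; lia. Qed.

Lemma syndrome_lt r : 0 < size r -> syndrome r < syndrome_bound r.
Proof.
move=> r_gt0; have e_gt0 := size_evens_gt0 r_gt0.
by do 2?[apply: ltn_mixed_radix]; apply: ltn_pmod.
Qed.

Lemma syndrome_inj r r' : 0 < size r -> size r = size r' ->
    syndrome r = syndrome r' ->
  [/\ maj r = maj r' %[mod size r],
      maj (evens r) = maj (evens r') %[mod uphalf (size r)]
    & maj (odds r) = maj (odds r') %[mod uphalf (size r)]].
Proof.
move=> r_gt0 eqsz; have e_gt0 := size_evens_gt0 r_gt0.
rewrite /syndrome -eqsz.
have [<- _] := size_evens_odds r.
have -> : size (evens r') = size (evens r).
  by have [-> _] := size_evens_odds r'; have [-> _] := size_evens_odds r; rewrite eqsz.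
case/mixed_radix_inj; try exact: ltn_pmod.
move=> -> /mixed_radix_inj; case; try exact: ltn_pmod.
by move=> -> ->.
Qed.

End SyndromeTheory.

Section Encoder.
Variables (T : eqType) (add : T -> T -> T) (z : T).
Variables (rank : T -> nat) (unrank : nat -> T).
Implicit Types x y v : seq T.

Definition fold_add (s : seq T) : T := foldr add z s.

(** Two letters in front preserve the parity classes of [y], and each check symbol falls into the
    class that it balances. *)
Definition add_checks y : seq T := [:: fold_add (evens y), fold_add (odds y) & y].

(* The candidates all encode the syndrome, and there are more of them than
   symbols to avoid. *)
Definition trailer v : T :=
  head z [seq w <- [seq unrank (syndrome (map rank v) + syndrome_bound (map rank v) * k)
                   | k <- iota 0 (size v)] | w \notin behead v].

(* Words are handled from right to left, so that the parity class of a check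
   symbol does not depend on the length of the message. *)
Definition encode x : seq T :=
  rev (trailer (add_checks (rev x)) :: add_checks (rev x)).

Lemma encodeE x : let v := add_checks (rev x) in
  encode x = x ++ [:: fold_add (odds (rev x)); fold_add (evens (rev x)); trailer v].
Proof. by rewrite /encode /= !rev_cons revK -!cats1 -!catA. Qed.

Lemma size_encode x : size (encode x) = size x + 3.
Proof. by rewrite encodeE size_cat. Qed.

Lemma take_encode n x : size x = n -> take n (encode x) = x.
Proof. by move=> <-; rewrite encodeE take_size_cat. Qed.

Variable q : nat.
Hypothesis unrankK : forall i, i < q -> rank (unrank i) = i.

(** Pigeonhole: the [size v] candidates have distinct ranks below [q], while [behead v] has only
    [size v - 1] letters. *)
Lemma trailerP v : 0 < size v -> syndrome_bound (map rank v) * size v <= q ->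
  rank (trailer v) %% syndrome_bound (map rank v) = syndrome (map rank v) /\
  trailer v \notin behead v.
Proof.
move=> v_gt0; rewrite /trailer.
set S := syndrome_bound _; set sg := syndrome _; set cand := map _ _ => leq_q.
have lt_sg : sg < S by apply: syndrome_lt; rewrite size_map.
have lt_q k : k < size v -> sg + S * k < q.
  by move=> kv; apply: leq_trans leq_q; apply: ltn_mixed_radix.
have : has (fun w => w \notin behead v) cand.
  rewrite has_predC; apply: contraL v_gt0 => /allP sub.
  have uniq_cand : uniq cand.
    rewrite map_inj_in_uniq ?iota_uniq // => j k.
    rewrite !mem_iota !add0n /= => jv kv /(congr1 rank).
    by rewrite !unrankK ?lt_q // => /mixed_radix_inj[].
  have := uniq_leq_size uniq_cand sub.
  by rewrite size_map size_iota size_behead; case: (size v) => //= m; rewrite ltnn.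
rewrite has_filter; case E: (filter _ _) => [|w s] // _ /=.
have : w \in [seq w <- cand | w \notin behead v] by rewrite E mem_head.
rewrite mem_filter => /andP[wv /mapP[k]]; rewrite mem_iota add0n => /= kv we.
split=> //; rewrite we unrankK ?lt_q //.
by rewrite addnC mulnC modnMDl modn_small.
Qed.

End Encoder.

(** The encoder uses the alphabet only through addition, zero, numbering and equality tests, so it
    commutes with injections that respect these. This turns a computation on bits into one in the
    field. *)
Lemma encode_map (T T' : eqType) (f : T -> T') add z rank unrank add' z' rank' unrank' :
    injective f -> (forall a b, f (add a b) = add' (f a) (f b)) -> f z = z' ->
    (forall a, rank' (f a) = rank a) -> (forall i, f (unrank i) = unrank' i) ->
  forall x, encode add' z' rank' unrank' (map f x) = map f (encode add z rank unrank x).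
Proof.
move=> f_inj fD fz f_rank f_unrank x.
have foldf s : fold_add add' z' (map f s) = f (fold_add add z s).
  by rewrite /fold_add; elim: s => //= a s ->.
have checkf y : add_checks add' z' (map f y) = map f (add_checks add z y).
  by rewrite /add_checks evens_map odds_map !foldf.
rewrite /encode -map_rev checkf map_rev; congr rev; rewrite [in RHS]/=; congr cons.
set v := add_checks _ _ _; rewrite /trailer -map_comp (eq_map f_rank) size_map.
rewrite -fz behead_map; set S := syndrome_bound _; set sg := syndrome _.
move: (behead v) => b; elim: (iota _ _) => //= k s IH.
rewrite -f_unrank mem_map //.
by case: ifP.
Qed.

(** * Bursts in codewords over a group of exponent two *)

Section Correction.
Import GRing.Theory.
Local Open Scope ring_scope.
Variables (A : zmodType) (rank : A -> nat) (unrank : nat -> A) (q : nat).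
Hypothesis addrr_A : forall a : A, a + a = 0.
Hypothesis rank_inj : injective rank.
Hypothesis unrankK : forall i, (i < q)%N -> rank (unrank i) = i.
Implicit Types y v : seq A.

Local Notation sum s := (\sum_(x <- s) x).
Local Notation checked := (add_checks +%R 0).
Local Notation last_symbol := (trailer 0 rank unrank).

Lemma sum_evens_odds v : sum v = sum (evens v) + sum (odds v).
Proof.
elim: v => [|a v IH]; first by rewrite !big_nil addr0.
by rewrite evens_cons odds_cons !big_cons IH [X in _ + X]addrC addrA.
Qed.

Lemma sum_checked y :
  sum (evens (checked y)) = 0 /\ sum (odds (checked y)) = 0.
Proof.
by rewrite /add_checks !(evens_cons, odds_cons) !big_cons /fold_add !foldrE !addrr_A.
Qed.

Lemma mem_behead_cat (u w : seq A) a : u != [::] -> a \in behead (u ++ a :: w).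
Proof. by case: u => //= b u _; rewrite mem_cat mem_head orbT. Qed.

(** For [v] of length [n + 2] this is the number of signatures times the number of representatives
    of each. *)
Definition room n := ((n + 2) * (uphalf (n + 2) * uphalf (n + 2)) * (n + 2) <= q)%N.

Lemma last_symbolP n y : room n -> size y = n ->
  let v := checked y in
  (rank (last_symbol v) %% syndrome_bound (map rank v))%N = syndrome (map rank v) /\
  last_symbol v \notin behead v.
Proof.
move=> qn sy v; have sv : size v = (n + 2)%N by rewrite /= sy addn2.
have := @trailerP A 0 rank unrank q unrankK v; apply; first by rewrite sv addn2.
by rewrite /syndrome_bound (size_evens_odds _).1 size_map sv.
Qed.

(* A burst reaching the last symbol of one codeword only would make the last
   symbol of the other one occur where [trailer] excludes it. *)
Lemma burst_at_end n y y' t W U' t' W' :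
    let v := checked y in let v' := checked y' in
    let h := last_symbol v in let h' := last_symbol v' in
    room n -> size y = n -> size y' = n ->
    (size t = 1 \/ size t = 2)%N -> size t' = size t ->
    h :: v = t ++ W -> v' = U' ++ t' ++ W' -> W = h' :: U' ++ W' ->
  y = y'.
Proof.
move=> v v' h h' qn sy sy'; have [_ h'P] := last_symbolP qn sy'.
have [sume sumo] := sum_checked y; have [sume' sumo'] := sum_checked y'.
case: t t' => [|a [|b [|d t]]] [|a' [|b' [|d' t']]] //= szt _; try by case: szt.
  case=> _ ev ev' eW.
  have sumv : sum v = 0 by rewrite sum_evens_odds sume sumo addr0.
  have sumv' : sum v' = 0 by rewrite sum_evens_odds sume' sumo' addr0.
  (* Both [v] and [v'] have sum zero, and they differ in that [a'] is lost and [h'] appears in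
     front. *)
  have eqa : h' = a'.
    have sumW : sum (h' :: U' ++ W') = 0 by rewrite -eW -ev.
    have : sum (h' :: U' ++ W') = sum (U' ++ a' :: W') by rewrite sumW -ev'.
    by rewrite big_cons !big_cat big_cons /= addrCA => /addIr.
  (* For empty [U'] the symbol [a'] is the check e of [v'], where [h'] may occur; then [v] and [v']
     agree after their first letter. *)
  have [U'0|U'0] := eqVneq U' [::].
    move: ev' ev; rewrite eW U'0 /v' /add_checks /= => -[_ <-] [_ _].
    exact.
  by case/negP: h'P; rewrite -/h' -/v' ev' eqa mem_behead_cat.
case=> _ _ ev ev' eW; rewrite eW in ev; case: ev => eo ey.
have [|U'0] := eqVneq U' [::].
  by move=> U'0; move: ev' ey; rewrite U'0 /= /v' /add_checks => -[_ _ ->].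
(* The check e of [v] is lost, so only its odd class is still known: it starts with [h'], which has
   landed in the place of o. Equal sums identify [h'] with the one of [a'], [b'] that lies in the
   odd class of [v']. *)
have : sum (odds v) = sum (odds v') by rewrite sumo sumo'.
rewrite /v /add_checks odds_cons evens_cons -/(odds _) eo ey ev'.
rewrite !odds_cat !odds_cons !evens_cons odds_cons big_cons !big_cat /=.
have := h'P; rewrite -/h' -/v' ev'.
case: (odd (size U')); rewrite big_cons addrCA => h'n /addIr eqa.
  by case/negP: h'n; rewrite eqa mem_behead_cat.
case/negP: h'n; rewrite eqa.
by rewrite -cat_rcons mem_behead_cat //; case: (U').
Qed.

(** In the reversed word the burst reaches h exactly when it is nonempty and its prefix [U] is
    empty. If this happens in both words, the surviving tails contain both messages; in one only,
    [burst_at_end] applies; in none, h is common, hence so is the signature. *)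
Lemma reversed_code n y y' U t W U' t' W' :
    let v := checked y in let v' := checked y' in
    room n -> size y = n -> size y' = n ->
    (size t <= 2)%N -> size t' = size t ->
    last_symbol v :: v = U ++ t ++ W ->
    last_symbol v' :: v' = U' ++ t' ++ W' -> U ++ W = U' ++ W' ->
  y = y'.
Proof.
move=> v v' qn sy sy' szt szt' E E' eqW.
case: t szt szt' E => [|a t] szt szt' E.
  case: t' szt' E' => // _ E'.
  by move: E'; rewrite /= -eqW -[U ++ W]E; case.
have {}szt : (size (a :: t) = 1 \/ size (a :: t) = 2)%N.
  by case: t szt {szt' E} => [|b [|]]; [left|right|].
case: U E eqW => [|u U] E eqW; case: U' E' eqW => [|u' U'] E' /= eqW.
- move: E E' szt'; rewrite eqW; case: t' => // a' t' [_ +] [_ +] [] /=.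
  case: t szt => [|b [|d t]] /= szt; last by case: szt.
    by case: t' => //= ev ev' _; move: ev'; rewrite -ev => -[_ _ ->].
  by case: t' => [|b' []] //= [_ ey] [_ ey'] _; move: ey'; rewrite -ey => -[_ ->].
- by case: E' => <- E' in eqW *; apply: (burst_at_end qn sy sy' szt szt' E E').
- case: E => <- E in eqW *; apply/esym.
  by apply: (burst_at_end qn sy' sy _ (esym szt') E' E (esym eqW)); rewrite szt'.
case: E E' eqW => eh E [eh' E'] [eqh eqW]; rewrite -eh -eh' in eqh.
have sz : size (map rank v) = size (map rank v') by rewrite !size_map /= sy sy'.
have eqS : syndrome_bound (map rank v) = syndrome_bound (map rank v').
  by rewrite /syndrome_bound sz !(size_evens_odds _).1 sz.
have [sg _] := last_symbolP qn sy; have [sg' _] := last_symbolP qn sy'.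
have {sg sg'} eqsg : syndrome (map rank v) = syndrome (map rank v').
  by rewrite -sg -sg' -/v -/v' eqS eqh.
have [maj0 maje majo] := syndrome_inj (ltn0Sn _ : 0 < size (map rank v))%N sz eqsg.
have [sume sumo] := sum_checked y; have [sume' sumo'] := sum_checked y'.
suff : v = v' by case.
rewrite !evens_map !odds_map !size_map in maj0 maje majo.
have eqsum : sum v = sum v'.
  by rewrite (sum_evens_odds v) (sum_evens_odds v') sume sumo sume' sumo'.
case: szt szt' E E' => /=.
  case: t => //; case: t' => [|a' []] // _ _ E E'; rewrite E E'.
  apply: (@single_deletion _ _ rank_inj (size v)) => //; rewrite -?E -?E' //.
case: t => [|b []] //; case: t' => [|a' [|b' []]] //= _ _ E E'; rewrite E E'.
by apply: (@burst2_deletion _ _ rank_inj (uphalf (size v))); rewrite -?E -?E' ?sume ?sumo.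
Qed.

End Correction.

(** * Encoder and decoder on words of bits *)

Ltac ptime_auto := repeat first
  [ exact: ptime_id | exact: ptime_cst | assumption
  | apply: ptime_fst | apply: ptime_snd | apply: ptime_pair
  | apply: ptime_filter | apply: ptime_allpairs | apply: ptime_map
  | apply: ptime_iota | apply: ptime_cons | apply: ptime_cat | apply: ptime_rev
  | apply: ptime_behead | apply: ptime_nilp | apply: ptime_negb
  | apply: ptime_take | apply: ptime_drop | apply: ptime_size
  | apply: ptime_sumn
  | apply: ptime_succ | apply: ptime_pred | apply: ptime_addn | apply: ptime_muln
  | apply: ptime_subn | apply: ptime_modn | apply: ptime_leq | apply: ptime_eqn
  | apply: ptime_andb | apply: ptime_addb | apply: ptime_head | apply: ptime_nth
  | apply: ptime_index | apply: ptime_mem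
  | apply: ptime_if ].

(** Removes the running offset, so that indexed sums suffice as a program. The default 0 of [nth] is
    the virtual last letter. *)
Lemma maj_fromE k s : maj_from k s =
  sumn [seq if nth 0 s i.+1 < nth 0 s i then (k + i).+1 else 0 | i <- iota 0 (size s)].
Proof.
elim: s k => //= a s IH k; rewrite IH nth0 addn0; congr (_ + _).
  by case: ifP => _ /=; rewrite ?mul1n.
congr sumn; rewrite -[1]addn0 iotaDl -map_comp; apply: eq_map => i /=.
by rewrite addSnnS.
Qed.

Lemma ptime_maj (C : encType) (s : C -> seq nat) : ptime s -> ptime (fun c => maj (s c)).
Proof.
move=> sP; apply: (ptime_comp sP).
apply: (@eq_ptime _ _ (fun s : seq nat => sumn
  [seq if nth 0 s i.+1 < nth 0 s i then i.+1 else 0 | i <- iota 0 (size s)])).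
  by move=> t; rewrite /maj maj_fromE.
by ptime_auto.
Qed.

Lemma ptime_unzip_parity (C A : encType) (s : C -> seq A) :
  ptime s -> ptime (fun c => unzip_parity (s c)).
Proof.
move=> sP.
apply: (@ptime_foldr _ _ _ (fun _ a (p : seq A * seq A) => (a :: p.2, p.1)) _ _
  (fun c => (esize (s c)).+1)) => //.
- by ptime_auto.
- by ptime_auto.
- exact/poly_boundedS/ptime_esize.
- by move=> c [u v] a le_a; rewrite !esize_pair esize_cons /=; lia.
Qed.

Lemma ptime_evens (C A : encType) (s : C -> seq A) :
  ptime s -> ptime (fun c => evens (s c)).
Proof. by move=> sP; apply/ptime_fst/ptime_unzip_parity. Qed.

Lemma ptime_odds (C A : encType) (s : C -> seq A) :
  ptime s -> ptime (fun c => odds (s c)).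
Proof. by move=> sP; apply/ptime_snd/ptime_unzip_parity. Qed.

Lemma ptime_syndrome (C : encType) (s : C -> seq nat) :
  ptime s -> ptime (fun c => syndrome (s c)).
Proof.
move=> sP; have := ptime_maj sP; have := ptime_evens sP; have := ptime_odds sP.
move=> oP eP mP; have := ptime_maj eP; have := ptime_maj oP.
by rewrite /syndrome => *; ptime_auto.
Qed.

Lemma ptime_syndrome_bound (C : encType) (s : C -> seq nat) :
  ptime s -> ptime (fun c => syndrome_bound (s c)).
Proof.
by move=> sP; have := ptime_evens sP; rewrite /syndrome_bound => *; ptime_auto.
Qed.

(** Addition of polynomials over F_2, lowest coefficient first. The longer tail is kept, so that
    lists of different lengths can be added. *)
Fixpoint bxor (s t : seq bool) : seq bool :=
  match s, t with
  | a :: s', b :: t' => a (+) b :: bxor s' t'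
  | [::], _ => t
  | _, [::] => s
  end.

Lemma bxors0 s : bxor s [::] = s. Proof. by case: s. Qed.

Lemma esize_behead (A : encType) (s : seq A) : esize (behead s) <= esize s.
Proof. by case: s => //= a s; rewrite esize_cons; lia. Qed.

Lemma esize_bool (b : bool) : esize b = (if b then 3 else 1).
Proof. by case: b. Qed.

Lemma esize_bxor s t : esize (bxor s t) <= esize s + esize t.
Proof.
elim: s t => [|a s IH] [|b t] //=; rewrite ?leq_addl ?leq_addr // !esize_cons.
by have := IH t; rewrite !esize_bool; case: a; case: b => /=; lia.
Qed.

Lemma ptime_bxor (C : encType) (s t : C -> seq bool) :
  ptime s -> ptime t -> ptime (fun c => bxor (s c) (t c)).
Proof.
move=> sP tP.
(* The state is the unread part of the second list and the reversed output. A default of [false]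
   continues an exhausted list; an unread rest is appended at the end. *)
pose step (st : seq bool * seq bool) (a : bool) :=
  (behead st.1, (a (+) head false st.1) :: st.2).
pose state c := foldl step (t c, [::]) (s c).
have stateP : ptime state.
  apply: (@ptime_foldl _ _ _ (fun=> step) _ _ (fun=> 5)) => //.
  - by ptime_auto.
  - by ptime_auto.
  - exact: poly_bounded_cst.
  - move=> c [u v] a _; rewrite /step !esize_pair /= esize_cons.
    have := esize_behead u; rewrite esize_bool; set k := esize (behead u).
    by case: ifP => _ /=; lia.
apply: (@eq_ptime _ _ (fun c => rev (state c).2 ++ (state c).1)); last by ptime_auto.
move=> c; rewrite /state; suff E u v w :
    rev (foldl step (v, w) u).2 ++ (foldl step (v, w) u).1 = rev w ++ bxor u v.
  by rewrite E.
elim: u v w => //= a u IH v w; rewrite /step IH /= rev_cons cat_rcons.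
by case: v => //= *; rewrite ?bxors0 ?addbF.
Qed.

(** Horner's scheme: [false :: u] is the product by X. There is no reduction, since the products are
    compared with a candidate modulus. *)
Definition bmul (s t : seq bool) : seq bool :=
  foldr (fun a u => bxor (if a then t else [::]) (false :: u)) [::] s.

Lemma ptime_bmul (C : encType) (s t : C -> seq bool) :
  ptime s -> ptime t -> ptime (fun c => bmul (s c) (t c)).
Proof.
move=> sP tP.
apply: (ptime_comp (f := fun c => (s c, t c)) (g := fun p => bmul p.1 p.2)).
  exact: ptime_pair.
apply: (@ptime_foldr _ _ _ (fun (c : seq bool * seq bool) (a : bool) u =>
  bxor (if a then c.2 else [::]) (false :: u)) _ _ (fun c => (esize c.2).+2)).
- by apply: ptime_bxor; ptime_auto.
- exact: ptime_cst.
- exact: (ptime_fst ptime_id).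
- by do 2!apply: poly_boundedS; apply: ptime_esize; apply: (ptime_snd ptime_id).
- move=> [c1 c2] b a _ /=; apply: leq_trans (esize_bxor _ _) _.
  have e0 : esize ([::] : seq bool) = 1 by [].
  have : 0 < esize c2 := tsize_gt0 _.
  by rewrite esize_cons esize_bool; case: a; rewrite ?e0; lia.
Qed.

(** * Enumeration of all words of bits *)

Fixpoint all_words m : seq (seq bool) :=
  if m is k.+1 then map (cons false) (all_words k) ++ map (cons true) (all_words k)
  else [:: [::]].

Lemma size_all_words m : size (all_words m) = 2 ^ m.
Proof. by elim: m => //= m IH; rewrite size_cat !size_map IH addnn expnS mul2n. Qed.

Lemma mem_map_cons_neg b (s : seq bool) (t : seq (seq bool)) :
  (~~ b :: s \in map (cons b) t) = false.
Proof. by apply/mapP => -[u _ []]; case: b. Qed.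

Lemma mem_all_words m w : (w \in all_words m) = (size w == m).
Proof.
elim: m w => [|m IH] [|a w] //.
  by rewrite mem_cat; apply/norP; split; apply/mapP => -[].
rewrite mem_cat /= eqSS -IH; have inj (b : bool) : injective (cons b) by move=> ?? [].
case: a; first by rewrite (mem_map_cons_neg false) (mem_map (inj true)).
by rewrite (mem_map_cons_neg true) (mem_map (inj false)) orbF.
Qed.

Lemma uniq_all_words m : uniq (all_words m).
Proof.
elim: m => //= m IH; have inj (b : bool) : injective (cons b) by move=> ?? [].
rewrite cat_uniq !(map_inj_uniq (inj _)) // IH andbT /=.
by apply/hasPn => w /mapP[u _ ->]; rewrite /= (mem_map_cons_neg false).
Qed.

Definition double_words K (W : seq (seq bool)) :=
  if size W + size W <= K then map (cons false) W ++ map (cons true) W else W.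

Lemma iter_double_words K i : 0 < K ->
  iter i (double_words K) [:: [::]] = all_words (minn i (trunc_log 2 K)).
Proof.
move=> K_gt0; elim: i => [|i IH]; first by rewrite min0n.
rewrite iterS IH /double_words size_all_words.
have /andP[leK ltK] := trunc_log_bounds (ltnSn 1) K_gt0.
have [lt_i|] := boolP (i < trunc_log 2 K); last rewrite -leqNgt => le_i.
  rewrite (minn_idPl (ltnW lt_i)) (minn_idPl lt_i) addnn -mul2n -expnS.
  by rewrite (leq_trans _ leK) // leq_exp2l.
rewrite (minn_idPr le_i) (minn_idPr (leqW le_i)) addnn -mul2n -expnS.
by rewrite leqNgt ltK.
Qed.

Lemma all_words_iter K : 0 < K ->
  all_words (trunc_log 2 K) = iter K (double_words K) [:: [::]].
Proof.
move=> K_gt0; rewrite iter_double_words //; congr all_words.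
apply/esym/minn_idPr.
exact: leq_trans (ltnW (ltn_expl _ (ltnSn 1))) (trunc_logP _ _).
Qed.

(** There are at most [K] words of at most [K] bits, so the list is polynomial in the unary [K],
    though exponential in its number of bits. *)
Lemma ptime_all_words (C : encType) (K : C -> nat) :
  ptime K -> ptime (fun c => all_words (trunc_log 2 (K c))).
Proof.
move=> KP; apply: (@eq_ptime _ _ (fun c => iter (K c) (double_words (K c)) [:: [::]])).
  move=> c; case: (posnP (K c)) => [->|K_gt0]; first by rewrite trunc_log0.
  by rewrite all_words_iter.
apply: (@ptime_iter_bounded _ (seq_encType (seq_encType bool_encType)) _
  (fun c => double_words (K c)) _
  (fun c => (esize (K c)) * ((esize (K c)).*2.*2 + 2).+1 + 1)) => //.
- have K'P : ptime (fun p : C * seq (seq bool) => K p.1).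
    by apply: (ptime_comp (f := fst) _ KP); ptime_auto.
  by rewrite /double_words; ptime_auto.
- exact: ptime_cst.
- have KB := ptime_esize KP; apply: poly_boundedD (poly_bounded_cst 1).
  apply: (poly_boundedM KB); apply: poly_boundedS.
  apply: poly_boundedD (poly_bounded_cst 2).
  apply: (@poly_bounded_le _ _ (fun c => 4 * esize (K c))) => [c|]; first by lia.
  exact: (poly_boundedM (poly_bounded_cst 4) KB).
move=> c i le_iK; have [K0|K_gt0] := posnP (K c).
  by move: le_iK; rewrite K0 leqn0 => /eqP ->.
rewrite iter_double_words //; set m := minn _ _.
have le_m : m <= K c by rewrite (leq_trans (geq_minl _ _)).
apply: (@leq_trans (size (all_words m) * (m.*2.*2 + 2).+1 + 1)).
  apply: esize_seq_le => j jm a; set w := nth _ _ _.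
  have /eqP <- : size w == m by rewrite -mem_all_words mem_nth.
  elim: w => //= b w IHw; rewrite esize_cons.
  have : esize b <= 3 by case: b.
  by lia.
rewrite leq_add2r leq_mul //; last by rewrite esize_nat; lia.
rewrite size_all_words esize_nat; apply: (@leq_trans (K c)); last by lia.
apply: leq_trans (trunc_logP (ltnSn 1) K_gt0).
by rewrite leq_exp2l // geq_minr.
Qed.

(* The alphabet is listed by W, whose first word is zero. *)
Definition encode_words (W x : seq (seq bool)) : seq (seq bool) :=
  encode bxor (head [::] W) (index^~ W) (nth (head [::] W) W) x.

Lemma ptime_fold_add (C : encType) (W s : C -> seq (seq bool)) :
  ptime W -> ptime s -> ptime (fun c => fold_add bxor (head [::] (W c)) (s c)).
Proof.
move=> WP sP.
apply: (@ptime_foldr _ _ (seq_encType bool_encType) (fun _ => bxor) _ _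
  (fun c => esize (s c))) => //.
- by apply: ptime_bxor; ptime_auto.
- by ptime_auto.
- exact: ptime_esize.
- by move=> c b a le_a; apply: leq_trans (esize_bxor _ _) _; lia.
Qed.

Lemma ptime_add_checks (C : encType) (W s : C -> seq (seq bool)) :
  ptime W -> ptime s -> ptime (fun c => add_checks bxor (head [::] (W c)) (s c)).
Proof.
move=> WP sP; have eP := ptime_evens sP; have oP := ptime_odds sP.
apply: ptime_cons; first exact: ptime_fold_add.
by apply: ptime_cons => //; apply: ptime_fold_add.
Qed.

Lemma ptime_trailer (C : encType) (W v : C -> seq (seq bool)) : ptime W -> ptime v ->
  ptime (fun c => trailer (head [::] (W c)) (index^~ (W c))
                          (nth (head [::] (W c)) (W c)) (v c)).
Proof.
move=> WP vP; have rP : ptime (fun c => [seq index w (W c) | w <- v c]).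
  apply: (@ptime_map C nat_encType (seq_encType bool_encType)
    (fun c w => index w (W c))) => //.
  have : ptime (fun p : C * seq bool => W p.1).
    by apply: (ptime_comp (f := fst) _ WP); ptime_auto.
  by move=> W1P; ptime_auto.
have sP := ptime_syndrome rP; have bP := ptime_syndrome_bound rP.
(* The ingredients are computed beforehand and stored in a tuple, so that the functions under
   binders only project and do arithmetic. *)
apply: (ptime_comp (f := fun c => (W c, (behead (v c), (size (v c),
  (syndrome [seq index w (W c) | w <- v c], syndrome_bound [seq index w (W c) | w <- v c])))))
  (g := fun p : seq (seq bool) * (seq (seq bool) * (nat * (nat * nat))) =>
    head (head [::] p.1) [seq w <- [seq nth (head [::] p.1) p.1
       (p.2.2.2.1 + p.2.2.2.2 * k) | k <- iota 0 p.2.2.1] | w \notin p.2.1])).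
  by ptime_auto.
by ptime_auto.
Qed.

Lemma ptime_encode_words (C : encType) (W x : C -> seq (seq bool)) :
  ptime W -> ptime x -> ptime (fun c => encode_words (W c) (x c)).
Proof.
move=> WP xP; have vP := ptime_add_checks WP (ptime_rev xP).
exact: ptime_rev (ptime_cons (ptime_trailer WP vP) vP).
Qed.

(** * Decoding by exhaustive insertion *)

Definition blocks (W : seq (seq bool)) r : seq (seq (seq bool)) :=
  if r == 0 then [:: [::]]
  else if r == 1 then [seq [:: a] | a <- W]
  else [seq [:: a; b] | a <- W, b <- W].

Definition candidates W n (y : seq (seq bool)) : seq (seq (seq bool)) :=
  [seq take d y ++ t ++ drop d y | d <- iota 0 (size y).+1,
                                   t <- blocks W (n + 3 - size y)].

(** Being a codeword is tested by encoding the first [n] symbols again. If no candidate passes, the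
    first one serves as default. *)
Definition decode_words W n y : seq (seq bool) :=
  take n (head (head [::] (candidates W n y))
    [seq z <- candidates W n y | z == encode_words W (take n z)]).

Lemma ptime_candidates (C : encType) (W : C -> seq (seq bool)) n y :
  ptime W -> ptime n -> ptime y -> ptime (fun c => candidates (W c) (n c) (y c)).
Proof.
move=> WP nP yP.
apply: (ptime_comp (f := fun c => (W c, (n c, y c)))
  (g := fun p : seq (seq bool) * (nat * seq (seq bool)) => candidates p.1 p.2.1 p.2.2)).
  by ptime_auto.
by rewrite /candidates /blocks; ptime_auto.
Qed.

Lemma ptime_decode_words (C : encType) (W : C -> seq (seq bool)) n y :
  ptime W -> ptime n -> ptime y -> ptime (fun c => decode_words (W c) (n c) (y c)).
Proof.
move=> WP nP yP; have cP := ptime_candidates WP nP yP.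
apply: (ptime_comp (f := fun c => (W c, (n c, candidates (W c) (n c) (y c))))
  (g := fun p : seq (seq bool) * (nat * seq (seq (seq bool))) =>
    take p.2.1 (head (head [::] p.2.2)
      [seq z <- p.2.2 | z == encode_words p.1 (take p.2.1 z)]))).
  by ptime_auto.
apply: ptime_take; first by ptime_auto.
apply: ptime_head; first by ptime_auto.
apply: ptime_filter; last by ptime_auto.
by apply: ptime_eq_words; last apply: ptime_encode_words; ptime_auto.
Qed.

(** For [f] of degree m and [W] the words of m bits, the factors range over all polynomials of
    degree below m. Equality with [f] is tested by the absence of true bits in a sum, which ignores
    zeros at the end. *)
Definition irreducible_word (W : seq (seq bool)) (f : seq bool) : bool :=
  nilp [seq s <- [seq bxor f (bmul g h) | g <- W, h <- W] | nilp [seq b <- s | b]].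

Definition modulus_word (W : seq (seq bool)) : seq bool :=
  head [::] [seq f <- [seq rcons w true | w <- W] | irreducible_word W f].

Lemma ptime_modulus_word (C : encType) (W : C -> seq (seq bool)) :
  ptime W -> ptime (fun c => modulus_word (W c)).
Proof.
move=> WP; apply: (ptime_comp WP); apply: ptime_head; first by ptime_auto.
apply: ptime_filter; last first.
  apply: ptime_map; last by ptime_auto.
  apply: (@eq_ptime _ _ (fun p : seq (seq bool) * seq bool => p.2 ++ [:: true])).
    by move=> p; rewrite cats1.
  by ptime_auto.
apply/ptime_nilp/ptime_filter; first by ptime_auto.
apply: ptime_allpairs; [|by ptime_auto|by ptime_auto].
by apply: ptime_bxor; last apply: ptime_bmul; ptime_auto.
Qed.

(** * Irreducible polynomials over F_2 *)

Section BinaryPolynomials.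
Import GRing.Theory.
Local Open Scope ring_scope.

(** The minimal polynomial over the prime field of a generator of the cyclic group of units of the
    field with 2^m elements. *)
Lemma exists_irreducible_F2 m : (0 < m)%N ->
  exists2 f : {poly 'F_2}, monic_irreducible_poly f & size f = m.+1.
Proof.
move=> m_gt0; have [F charF cardF] := pPrimePowerField (isT : prime 2) m_gt0.
pose L := pPrimeCharType charF.
have /cyclicP[u genu] := field_unit_group_cyclic [set: {unit F}]%G.
pose a : L := FinRing.uval u.
(* Every nonzero element is a power of [a], so [a] generates the whole field and its degree is m. *)
have defL : <<1%AS; a>>%VS = fullv :> {vspace L}.
  apply/eqP; rewrite eqEsubv subvf; apply/subvP => x _.
  have [->|x_neq0] := eqVneq x 0; first exact: mem0v.
  have Ux : (x : F) \is a GRing.unit by rewrite unitfE.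
  have /cycleP[i xE] : FinRing.unit F Ux \in <[u]>%g by rewrite -genu inE.
  have -> : x = a ^+ i.
    by rewrite /a -[LHS]/(FinRing.uval (FinRing.unit F Ux)) xE FinRing.val_unitX.
  by rewrite rpredX // memv_adjoin.
have dimL : \dim (fullv : {vspace L}) = m.
  rewrite pprimeChar_dimf; apply/eqP; rewrite -(eqn_exp2l _ _ (ltnSn 1)).
  by rewrite -card_pprimeChar -cardF.
have sz : size (minPoly 1%AS a) = m.+1.
  by rewrite size_minPoly adjoin_degreeE defL dimL dimv1 divn1.
(* The coefficients lie in the prime field, so the polynomial comes from ['F_2]; a divisor over
   ['F_2] is mapped to one over the prime field, where [minPoly_irr] applies. *)
have /polyOver1P[f fE] := minPolyOver 1%AS a.
have monf : f \is monic.
  by rewrite -(map_monic (in_alg L)) -fE monic_minPoly.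
have szf : size f = m.+1 by rewrite -sz fE size_map_poly.
exists f => //; split=> //; split; first by rewrite szf.
move=> r szr dvd_rf.
have Kr : map_poly (in_alg L) r \is a polyOver 1%AS by apply/polyOver1P; exists r.
have dvd_r : map_poly (in_alg L) r %| minPoly 1%AS a by rewrite fE dvdp_map.
have /orP[] := minPoly_irr Kr dvd_r; first by rewrite fE eqp_map.
rewrite -(rmorph1 (map_poly (in_alg L))) eqp_map => /eqp_size.
by rewrite size_poly1 => /eqP; rewrite (negPf szr).
Qed.

Definition bpoly (s : seq bool) : {poly 'F_2} := Poly [seq (b%:R : 'F_2) | b : bool <- s].

Definition pbits k (p : {poly 'F_2}) : seq bool := [seq p`_i != 0 | i <- iota 0 k].

Lemma bpoly_cons b s : bpoly (b :: s) = bpoly s * 'X + (b%:R)%:P.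
Proof. by rewrite /bpoly /= cons_poly_def. Qed.

Lemma F2_nat_neq0 (a : 'F_2) : (a != 0)%:R = a.
Proof. by apply/val_inj; case: a => [[|[|]]]. Qed.

Lemma F2_addb (a b : bool) : (a (+) b)%:R = a%:R + b%:R :> 'F_2.
Proof. by apply/val_inj; case: a b => [] []. Qed.

Lemma bpoly_bxor s t : bpoly (bxor s t) = bpoly s + bpoly t.
Proof.
elim: s t => [|a s IH] [|b t]; rewrite ?[bpoly [::]]/(_ : {poly 'F_2}) ?add0r ?addr0 //.
rewrite [bxor _ _]/= !bpoly_cons IH F2_addb polyCD mulrDl.
by rewrite !addrA; congr (_ + _); rewrite -!addrA; congr (_ + _); rewrite addrC.
Qed.

Lemma bpoly_bmul s t : bpoly (bmul s t) = bpoly s * bpoly t.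
Proof.
elim: s => [|a s IH]; first by rewrite mul0r.
rewrite [bmul _ _]/= -/(bmul s t) bpoly_bxor !bpoly_cons IH addr0 mulrDl addrC.
rewrite mulrAC; congr (_ + _).
by case: a; rewrite ?mul1r ?mul0r.
Qed.

Lemma coef_bpoly s i : (bpoly s)`_i = (nth false s i)%:R.
Proof.
rewrite coef_Poly; have [lt_is|le_si] := ltnP i (size s).
  by rewrite (nth_map false).
by rewrite !nth_default ?size_map.
Qed.

Lemma size_pbits k p : size (pbits k p) = k.
Proof. by rewrite size_map size_iota. Qed.

Lemma bpolyK s : pbits (size s) (bpoly s) = s.
Proof.
apply: (@eq_from_nth _ false) => [|i]; rewrite size_pbits // => lt_is.
rewrite (nth_map 0%N) ?size_iota // nth_iota // add0n coef_bpoly.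
by case: (nth _ _ _).
Qed.

Lemma pbitsK k (p : {poly 'F_2}) : (size p <= k)%N -> bpoly (pbits k p) = p.
Proof.
move=> le_pk; apply/polyP => i; rewrite coef_bpoly.
have [lt_ik|le_ki] := ltnP i k.
  by rewrite (nth_map 0%N) ?size_iota // nth_iota // add0n F2_nat_neq0.
by rewrite !nth_default ?size_pbits // (leq_trans le_pk).
Qed.

Lemma pbits0 k : pbits k 0 = nseq k false.
Proof.
apply: (@eq_from_nth _ false) => [|i]; rewrite size_pbits ?size_nseq // => lt_ik.
by rewrite (nth_map 0%N) ?size_iota // coef0 nth_nseq lt_ik eqxx.
Qed.

Lemma pbitsD k (p q : {poly 'F_2}) : pbits k (p + q) = bxor (pbits k p) (pbits k q).
Proof.
rewrite /pbits; elim: (iota 0 k) => //= i s ->; rewrite coefD; congr cons.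
by case: (p`_i) (q`_i) => [[|[|]]] // ? [[|[|]]].
Qed.

Lemma size_bpoly_le s : (size (bpoly s) <= size s)%N.
Proof. by rewrite (leq_trans (size_Poly _)) ?size_map. Qed.

Lemma bpoly_eq0 s : (bpoly s == 0) = nilp [seq b <- s | b].
Proof.
rewrite /nilp size_filter -leqn0 leqNgt -has_count; apply/eqP/idP => [s0|].
  apply/hasPn => -[] // /(nthP false)[i _ si].
  by have := coef_bpoly s i; rewrite s0 coef0 si => /esym/eqP; rewrite oner_eq0.
move/hasPn => s0; apply/polyP => i; rewrite coef_bpoly coef0.
have [lt_is|le_si] := ltnP i (size s); last by rewrite nth_default.
by have /s0 := mem_nth false lt_is; case: (nth _ _ _).
Qed.

Lemma size_bpoly_rcons w : size (bpoly (rcons w true)) = (size w).+1.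
Proof.
apply/eqP; rewrite eqn_leq (leq_trans (size_bpoly_le _)) ?size_rcons //=.
by apply: contraT; rewrite -leqNgt => /leq_sizeP/(_ _ (leqnn _))/eqP;
  rewrite coef_bpoly nth_rcons ltnn eqxx oner_eq0.
Qed.

Lemma monic_bpoly_rcons w : bpoly (rcons w true) \is monic.
Proof.
by rewrite monicE lead_coefE size_bpoly_rcons coef_bpoly nth_rcons ltnn eqxx.
Qed.

(** A factorisation of a polynomial of degree m into factors of degree below m has no constant
    factor; conversely, a proper divisor and its cofactor both fit into m bits. *)
Lemma irreducible_wordP w : (0 < size w)%N ->
  reflect (irreducible_poly (bpoly (rcons w true)))
          (irreducible_word (all_words (size w)) (rcons w true)).
Proof.
set m := size w; set f := rcons w true; move=> m_gt0.
have szf : size (bpoly f) = m.+1 := size_bpoly_rcons w.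
have nzf : bpoly f != 0 by rewrite -size_poly_eq0 szf.
have F2_subr (p q : {poly 'F_2}) : (p + q == 0) = (p == q).
  have ch : 2 \in [pchar {poly 'F_2}] by rewrite pchar_poly pchar_Fp.
  by rewrite addr_eq0 (oppr_pchar2 ch).
have zeroE g h : (size [seq b <- bxor f (bmul g h) | b] == 0)%N =
    (bpoly f == bpoly g * bpoly h).
  by rewrite -[LHS]/(nilp _) -bpoly_eq0 bpoly_bxor bpoly_bmul F2_subr.
rewrite /irreducible_word /nilp size_filter -leqn0 leqNgt -has_count.
apply: (iffP idP) => [irr|[_ irr]].
  split=> [|p szp dvd_pf]; first by rewrite szf.
  apply: contraR irr => not_eqp; apply/hasP.
  have nzp : p != 0 by apply: contraTneq dvd_pf => ->; rewrite dvd0p.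
  have lt_pf : (size p < m.+1)%N.
    by rewrite -szf ltn_neqAle dvdp_leq // andbT dvdp_size_eqp.
  have /dvdpP[r fE] := dvd_pf.
  have nzr : r != 0 by apply: contraNneq nzf => r0; rewrite fE r0 mul0r.
  have szr : (size r <= m)%N.
    have := size_mul nzr nzp; rewrite -fE szf => E.
    have : (size p != 0)%N by rewrite size_poly_eq0.
    by move: szp E; move: (size p) (size r) => a b; lia.
  exists (bxor f (bmul (pbits m r) (pbits m p))).
    by apply/allpairsP; exists (pbits m r, pbits m p); rewrite !mem_all_words !size_pbits !eqxx.
  by rewrite zeroE !pbitsK // fE.
apply/hasP => -[s /allpairsP[[g h] /= [gW hW ->]]]; rewrite zeroE => /eqP fE.
rewrite !mem_all_words in gW hW.
have szg := size_bpoly_le g; have szh := size_bpoly_le h.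
rewrite (eqP gW) in szg; rewrite (eqP hW) in szh.
have dvd_gf : bpoly g %| bpoly f by rewrite fE dvdp_mulr.
have [sz1|szn1] := eqVneq (size (bpoly g)) 1%N.
  have : (size (bpoly f) <= size (bpoly g) + size (bpoly h) - 1)%N.
    by rewrite fE subn1 size_polyMleq.
  by rewrite szf sz1; lia.
by have /eqp_size E := irr _ szn1 dvd_gf; move: szg; rewrite E szf ltnn.
Qed.

Lemma modulus_wordP m : (0 < m)%N -> let s := modulus_word (all_words m) in
  (size s = m.+1 /\ size (bpoly s) = m.+1) /\ monic_irreducible_poly (bpoly s).
Proof.
move=> m_gt0; rewrite /modulus_word.
have [f [irrf monf] szf] := exists_irreducible_F2 m_gt0.
case E: (filter _ _) => [|s t] /=.
  have : has (irreducible_word (all_words m)) [seq rcons w true | w <- all_words m].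
    pose w := pbits m f; have szw : size w = m by rewrite size_pbits.
    have fE : bpoly (rcons w true) = f.
      rewrite -[RHS](@pbitsK m.+1) ?szf //; congr bpoly.
      rewrite /pbits -(addn1 m) iotaD map_cat cats1; congr rcons.
      by move: monf; rewrite monicE lead_coefE szf /= add0n => /eqP ->; rewrite oner_eq0.
    apply/hasP; exists (rcons w true).
      by apply/mapP; exists w; rewrite ?mem_all_words ?szw.
    by rewrite -szw; apply/irreducible_wordP; rewrite ?szw // fE.
  by rewrite has_filter E.
have : s \in [seq f0 <- [seq rcons w true | w <- all_words m]
              | irreducible_word (all_words m) f0] by rewrite E mem_head.
rewrite mem_filter => /andP[+ /mapP[w]]; rewrite mem_all_words => irr /eqP szw sE.
rewrite sE size_rcons size_bpoly_rcons szw; split=> //; split; last exact: monic_bpoly_rcons.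
by apply/irreducible_wordP; rewrite szw // -sE.
Qed.

End BinaryPolynomials.

(** * Field elements as words *)

Section Bursts.
Variable T : eqType.
Implicit Types z w : seq T.

Lemma burst_descendantP r z w : burst_descendant r z w ->
  exists u t v, [/\ size t = r, z = u ++ t ++ v & w = u ++ v].
Proof.
case: r => [->|r] /=; first by exists z, [::], [::]; split; rewrite ?cats0.
case=> le_rz [d /andP[d_gt0 le_d] ->].
exists (take d.-1 z), (take r.+1 (drop d.-1 z)), (drop (d.-1 + r.+1) z); split=> //.
  by rewrite size_takel // size_drop; lia.
by rewrite addnC -drop_drop cat_take_drop cat_take_drop.
Qed.

End Bursts.

Section WordDecoder.
Variables m n : nat.
Let W := all_words m.
Let zero := head [::] W.

Lemma head_all_words k : head [::] (all_words k) = nseq k false.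
Proof.
elim: k => //= k <-.
by case: (all_words k) (size_all_words k) => // /esym/eqP; rewrite expn_eq0.
Qed.

Lemma size_nth_all_words i : size (nth zero W i) = m.
Proof.
have [lt_i|le_i] := ltnP i (size W).
  by apply/eqP; rewrite -mem_all_words mem_nth.
by rewrite nth_default // /zero /W head_all_words size_nseq.
Qed.

Lemma mem_blocks r s : r <= 2 ->
  (s \in blocks W r) = (size s == r) && all (fun w => size w == m) s.
Proof.
have injs : injective (fun a : seq bool => [:: a]) by move=> ?? [].
case: r => [|[|[|]]] // _; rewrite /blocks /=.
- by case: s => // a s; rewrite inE /=.
- case: s => [|a [|b s]] /=; rewrite ?andbT.
  + by apply/mapP => -[].
  + by rewrite (mem_map injs) mem_all_words.
  + by apply/mapP => -[].
case: s => [|a [|b [|c s]]] /=; rewrite ?andbT; try by apply/allpairsP => -[[? ?] [_ _]].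
apply/allpairsP/andP => [[[a' b'] /= [aW bW [-> ->]]]|[/eqP aW /eqP bW]].
  by rewrite -!mem_all_words.
by exists (a, b); rewrite !mem_all_words aW bW !eqxx.
Qed.

Lemma candidatesP y z : n + 1 <= size y <= n + 3 ->
  reflect (exists u t v, [/\ y = u ++ v, z = u ++ t ++ v, size t = n + 3 - size y
                         & all (fun w => size w == m) t])
          (z \in candidates W n y).
Proof.
move=> szy; have r2 : n + 3 - size y <= 2 by lia.
apply: (iffP allpairsP) => [[[d t] /= [dI tB ->]]|[u [t [v [yE zE szt tW]]]]].
  exists (take d y), t, (drop d y); rewrite cat_take_drop.
  by move: tB; rewrite mem_blocks // => /andP[/eqP].
exists (size u, t); split.
- by rewrite mem_iota /= add0n ltnS yE size_cat leq_addr.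
- by rewrite mem_blocks // szt eqxx.
- by rewrite /= yE zE take_size_cat // drop_size_cat.
Qed.

(** The decoder must also behave on words that descend from no codeword, since its running time is
    claimed for them too. *)
Lemma decode_words_size y : n + 1 <= size y <= n + 3 ->
    all (fun w => size w == m) y ->
  size (decode_words W n y) = n /\ all (fun w => size w == m) (decode_words W n y).
Proof.
move=> szy yW; rewrite /decode_words; set z := head _ _.
have : z \in candidates W n y.
  have : head [::] (candidates W n y) \in candidates W n y.
    rewrite -nth0 mem_nth //.
    (* Padding with zeros shows that there is a candidate, so the default of [decode_words] is a
       genuine word. *)
    have : y ++ nseq (n + 3 - size y) zero \in candidates W n y.
      apply/candidatesP => //; exists y, (nseq (n + 3 - size y) zero), [::].
      rewrite !cats0 size_nseq; split=> //; apply/allP => w /nseqP[-> _].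
      by rewrite /zero /W head_all_words size_nseq.
    by case: (candidates W n y).
  rewrite /z; case E: (filter _ _) => [|z' s] //= _.
  have : z' \in [seq z <- candidates W n y | z == encode_words W (take n z)].
    by rewrite E mem_head.
  by rewrite mem_filter => /andP[].
case/(candidatesP _ szy) => u [t [v [yE -> szt tW]]].
have szz : size (u ++ t ++ v) = n + 3.
  by move: szy; rewrite !size_cat szt yE size_cat; lia.
split; first by rewrite size_takel // szz leq_addr.
apply/allP => w /mem_take; move: w; apply/allP.
by move: yW; rewrite yE !all_cat tW => /andP[-> ->].
Qed.

End WordDecoder.
Arguments candidatesP {m n y z}.

Section Model.
Variables (m : nat) (M : field_model).
Hypothesis size_modulus : size (modulus M) = m.+1.

Local Notation F := (model_field M).
Let W := all_words m.
Let zero := head [::] W.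

Definition elt_bits (a : F) : seq bool := pbits m (val a).
Definition bits_elt (w : seq bool) : F := in_qpoly (modulus M) (bpoly w).
Definition elt_rank (a : F) : nat := index (elt_bits a) W.
Definition elt_unrank (i : nat) : F := bits_elt (nth zero W i).

Lemma size_val_elt (a : F) : (size (val a : {poly 'F_2}) <= m)%N.
Proof.
rewrite -ltnS; apply: leq_trans (size_mk_monic (a : {poly %/ modulus M})) _.
(* The quotient type reduces modulo [mk_monic] of its modulus, which is the modulus itself for a
   monic polynomial of positive degree. *)
by rewrite mk_monicE ?size_modulus //; apply: modulusP.
Qed.

Lemma elt_bitsK : cancel elt_bits bits_elt.
Proof.
move=> a; apply: val_inj; rewrite /bits_elt /elt_bits pbitsK ?size_val_elt //.
by apply: in_qpoly_small; apply: size_mk_monic.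
Qed.

Lemma bits_eltK w : size w = m -> elt_bits (bits_elt w) = w.
Proof.
move=> szw; rewrite /elt_bits -[RHS]bpolyK szw; congr pbits.
apply: in_qpoly_small; rewrite mk_monicE; last exact: modulusP.
by rewrite size_modulus ltnS -szw size_bpoly_le.
Qed.

Lemma elt_bits_inj : injective elt_bits.
Proof. exact: can_inj elt_bitsK. Qed.

Lemma size_elt_bits a : size (elt_bits a) = m.
Proof. exact: size_pbits. Qed.

Lemma mem_elt_bits a : elt_bits a \in W.
Proof. by rewrite mem_all_words size_elt_bits. Qed.

Lemma elt_bitsD a b : elt_bits (a + b)%R = bxor (elt_bits a) (elt_bits b).
Proof. exact: pbitsD. Qed.

Lemma elt_bits0 : elt_bits 0%R = zero.
Proof. by rewrite /zero /W head_all_words; apply: pbits0. Qed.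

Lemma elt_rank_inj : injective elt_rank.
Proof.
move=> a b /(congr1 (nth [::] W)).
by rewrite !nth_index ?mem_elt_bits // => /elt_bits_inj.
Qed.

Lemma elt_bits_unrank i : elt_bits (elt_unrank i) = nth zero W i.
Proof. by rewrite bits_eltK // size_nth_all_words. Qed.

Lemma elt_unrankK i : (i < 2 ^ m)%N -> elt_rank (elt_unrank i) = i.
Proof.
move=> lt_i; rewrite /elt_rank elt_bits_unrank index_uniq ?uniq_all_words //.
by rewrite size_all_words.
Qed.

Lemma addrr_elt (a : F) : (a + a = 0)%R.
Proof.
apply: elt_bits_inj; rewrite elt_bitsD elt_bits0 /zero /W head_all_words.
rewrite -(size_elt_bits a); elim: (elt_bits a) => //= b s ->.
by rewrite addbb.
Qed.

Lemma enc_eltE (a : F) : enc_elt a = enc (elt_bits a).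
Proof.
rewrite /enc_elt /enc_poly size_modulus /= /elt_bits /pbits -map_comp.
by congr enc_seq; apply: eq_map => i /=; rewrite /enc_bit; case: eqP.
Qed.

Lemma enc_wordE (s : seq F) : enc_word s = enc [seq elt_bits a | a <- s].
Proof.
by rewrite /enc_word /= -map_comp; congr enc_seq; apply: eq_map => a; apply: enc_eltE.
Qed.

Lemma map_bits_eltK (s : seq (seq bool)) : all (fun w => size w == m) s ->
  map elt_bits (map bits_elt s) = s.
Proof.
move/allP=> szs; rewrite -map_comp map_id_in // => w /szs/eqP.
exact: bits_eltK.
Qed.

Definition elt_encode (x : seq F) : seq F :=
  encode +%R 0%R elt_rank elt_unrank x.

Lemma encode_words_bits x :
  encode_words W (map elt_bits x) = map elt_bits (elt_encode x).
Proof.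
apply: encode_map => //.
- exact: elt_bits_inj.
- exact: elt_bitsD.
- exact: elt_bits0.
- exact: elt_bits_unrank.
Qed.

Variable n : nat.
Hypothesis room_n : room (2 ^ m) n.

Lemma elt_encode_burst x u t v x' u' t' v' :
    size x = n -> size x' = n -> size t <= 2 -> size t' = size t ->
    elt_encode x = u ++ t ++ v -> elt_encode x' = u' ++ t' ++ v' ->
    u ++ v = u' ++ v' ->
  x = x'.
Proof.
move=> szx szx' szt szt' /(congr1 rev) E /(congr1 rev) E' /(congr1 rev) eqw.
apply: (can_inj revK).
move: E E' eqw; rewrite /elt_encode /encode !revK !rev_cat -!catA => E E' eqw.
apply: (reversed_code addrr_elt elt_rank_inj elt_unrankK room_n _ _ _ _ E E' eqw);
  by rewrite ?size_rev.
Qed.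

(** The sent codeword is among the candidates and passes the test. Any candidate [z] that passes is
    the codeword of some [x'] with the same descendant [y], so [x' = x] by [elt_encode_burst]. *)
Lemma decode_words_encode b x y : b <= 2 -> size x = n ->
  burst_descendant b (elt_encode x) y ->
  decode_words W n (map elt_bits y) = map elt_bits x.
Proof.
move=> b2 szx /burst_descendantP[u [t [v [szt cE yE]]]].
have szc : size (elt_encode x) = n + 3 by rewrite size_encode szx.
have szy : size (map elt_bits y) = n + 3 - b.
  by move: szc; rewrite size_map cE yE !size_cat szt; lia.
have b3 : b <= n + 3 by move: szc; rewrite cE !size_cat szt; lia.
have bE : n + 3 - size (map elt_bits y) = b by rewrite szy; lia.
have szy' : n + 1 <= size (map elt_bits y) <= n + 3 by rewrite szy; lia.
rewrite /decode_words; set ok := fun z => _ == _.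
have : has ok (candidates W n (map elt_bits y)).
  apply/hasP; exists (map elt_bits (elt_encode x)); last first.
    by rewrite /ok -map_take /elt_encode (take_encode _ _ _ _ szx) encode_words_bits.
  apply/candidatesP => //; exists (map elt_bits u), (map elt_bits t), (map elt_bits v).
  rewrite bE size_map szt cE yE !map_cat; split=> //.
  by apply/allP => w /mapP[a _ ->]; rewrite size_elt_bits.
rewrite has_filter; case E: (filter _ _) => [|z s] // _ /=.
have : z \in [seq z <- candidates W n (map elt_bits y) | ok z] by rewrite E mem_head.
rewrite mem_filter => /andP[/eqP zE /(candidatesP szy')[u' [t' [v' [yE' zE' szt' tW]]]]].
have uvW : all (fun w => size w == m) (u' ++ v').
  by rewrite -yE'; apply/allP => w /mapP[a _ ->]; rewrite size_elt_bits.
have zW : all (fun w => size w == m) z.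
  by move: uvW; rewrite zE' !all_cat tW => /andP[-> ->].
have szz : size z = n + 3.
  have := congr1 size yE'; rewrite szy size_cat zE' !size_cat szt' bE.
  by move: (size u') (size v') => i j; lia.
pose x' := map bits_elt (take n z).
have x'E : map elt_bits x' = take n z.
  by rewrite map_bits_eltK //; apply/allP => w /mem_take; move: w; apply/allP.
have {}zE : map elt_bits (elt_encode x') = z by rewrite -encode_words_bits x'E -zE.
rewrite -x'E; congr map.
apply/esym; apply: (@elt_encode_burst x u t v x' (map bits_elt u') (map bits_elt t')
  (map bits_elt v')) => //.
- by rewrite size_map size_takel // szz leq_addr.
- by rewrite szt.
- by rewrite size_map szt' bE szt.
- by rewrite -!map_cat -zE' -zE mapK //; apply: elt_bitsK.
by rewrite -map_cat -yE' mapK -?yE //; apply: elt_bitsK.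
Qed.

Lemma size_elt_encode (x : n.-tuple F) : size (elt_encode x) == n + 3.
Proof. by rewrite size_encode size_tuple. Qed.

End Model.
Arguments elt_bits m {M} a.

(** * Choice of the alphabet *)

(** The predecessor makes 2 to this power the largest power of two strictly below [(n + 2) ^ 4],
    hence at least half of it. *)
Definition degree n := trunc_log 2 ((n + 2) ^ 4).-1.

Lemma expn4_gt1 n : 1 < (n + 2) ^ 4.
Proof. by rewrite -[1](exp1n 4) ltn_exp2r // addn2. Qed.

Lemma degree_gt0 n : 0 < degree n.
Proof.
rewrite trunc_log_gt0 /= -ltnS prednK; last exact: ltnW (expn4_gt1 n).
have : 2 ^ 4 <= (n + 2) ^ 4 by rewrite leq_exp2r // addn2.
by apply: leq_trans.
Qed.

Lemma degree_bounds n : 2 ^ degree n < (n + 2) ^ 4 <= 2 ^ (degree n).+1.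
Proof.
have K_gt0 : 0 < ((n + 2) ^ 4).-1 by have := expn4_gt1 n; case: (_ ^ 4) => [|[]].
have := trunc_log_bounds (ltnSn 1) K_gt0; rewrite -/(degree n).
by move: K_gt0; case: ((n + 2) ^ 4) => //= K _; rewrite ltnS.
Qed.

Lemma room_degree n : 1 <= n -> room (2 ^ degree n) n.
Proof.
move=> n_gt0; rewrite /room; have /andP[_] := degree_bounds n.
rewrite [2 ^ _]expnS; set Q := 2 ^ degree n; set U := uphalf (n + 2) => leQ.
(* It remains to see 2 U^2 <= (n + 2)^2. From 2 U <= n + 3 this follows because (n + 3)^2 <= 2 (n +
   2)^2 for n >= 1. *)
have U2 : 2 * U <= n + 3 by rewrite /U; lia.
rewrite -(leq_pmul2l (ltn0Sn 1)); apply: leq_trans leQ.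
have -> : (n + 2) ^ 4 = (n + 2) * (n + 2) * ((n + 2) * (n + 2)).
  by rewrite !expnS expn0 muln1 !mulnA.
have -> : 2 * ((n + 2) * (U * U) * (n + 2)) = (n + 2) * (n + 2) * (2 * (U * U)) by lia.
rewrite leq_mul2l; apply/orP; right.
by nia.
Qed.

Definition adj_model n : field_model :=
  FieldModel (proj2 (modulus_wordP (degree_gt0 n))).

Lemma size_adj_modulus n : size (modulus (adj_model n)) = (degree n).+1.
Proof. by have [[_ ->] _] := modulus_wordP (degree_gt0 n). Qed.

Lemma enc_adj_model n : enc_model (adj_model n) = enc (modulus_word (all_words (degree n))).
Proof.
have [[szs _] _] := modulus_wordP (degree_gt0 n).
rewrite /enc_model /enc_poly size_adj_modulus -szs.
rewrite -[in RHS](bpolyK (modulus_word _)) /pbits /enc /= -map_comp.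
by congr enc_seq; apply: eq_map => i /=; rewrite /enc_bit; case: eqP.
Qed.

Lemma card_adj_model n : #|model_field (adj_model n)| = 2 ^ degree n.
Proof. by rewrite card_qfpoly size_adj_modulus card_Fp. Qed.

Definition adj_encode n (x : n.-tuple (model_field (adj_model n))) :
    (n + 3).-tuple (model_field (adj_model n)) :=
  Tuple (size_elt_encode (degree n) x).

(** The zero tuple makes the function total; by [adj_decodeE] it does not replace the decoded word
    on inputs of admissible length. *)
Definition adj_decode n (y : seq (model_field (adj_model n))) :
    n.-tuple (model_field (adj_model n)) :=
  insubd [tuple of nseq n 0%R]
    (map (@bits_elt (adj_model n))
       (decode_words (all_words (degree n)) n (map (elt_bits (degree n)) y))).

Lemma adj_decodeE n y : n + 1 <= size y <= n + 3 ->
  map (elt_bits (degree n)) (@adj_decode n y) =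
  decode_words (all_words (degree n)) n (map (elt_bits (degree n)) y).
Proof.
move=> szy; have szM := size_adj_modulus n.
have [||szd dW] := @decode_words_size (degree n) n (map (elt_bits (degree n)) y).
- by rewrite size_map.
- by apply/allP => w /mapP[a _ ->]; rewrite size_elt_bits.
rewrite /adj_decode val_insubd size_map szd eqxx.
exact: map_bits_eltK.
Qed.

Section InputSize.

Lemma esize_word_le m (w : seq bool) : size w = m -> esize w <= 4 * m + 1.
Proof.
move=> <-; elim: w => //= b w IH; rewrite esize_cons esize_bool.
by case: b; lia.
Qed.

(** The input has size below 64 N^2 with N = n + m, and 64 = 2^6 <= N^6 because N >= 2; hence the
    exponent 8. *)
Lemma input_size_le n m (s : seq (seq bool)) (k : nat) : 1 <= n -> 0 < m ->
    size s <= n + 3 -> all (fun w => size w == m) s ->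
  (esize (n, s)).+1 ^ k <= (n + m) ^ (8 * k).
Proof.
move=> n_gt0 m_gt0 szs /all_nthP sW; rewrite expnM; apply: leq_exp2r_homo.
have le_s : esize s <= size s * (4 * m + 2) + 1.
  have := @esize_seq_le _ s (4 * m + 1); rewrite -addnS; apply => i lt_i a.
  by apply: esize_word_le; rewrite (set_nth_default [::]) //; apply/eqP/sW.
set N := n + m; have N2 : 2 <= N by rewrite /N; lia.
apply: (@leq_trans (N ^ 2 * 2 ^ 6)); last first.
  by rewrite -[8]/(2 + 6) expnD leq_mul2l leq_exp2r // N2 orbT.
rewrite esize_pair esize_nat.
have : size s * (4 * m + 2) <= (n + 3) * (4 * m + 2) by rewrite leq_mul2r szs orbT.
rewrite -mulnn /N; nia.
Qed.

End InputSize.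

Lemma ptime_degree_words (C : encType) (n : C -> nat) :
  ptime n -> ptime (fun c => all_words (degree (n c))).
Proof.
move=> nP; apply: ptime_all_words; apply: ptime_pred.
apply: (@eq_ptime _ _ (fun c => (n c + 2) * (n c + 2) * ((n c + 2) * (n c + 2)))).
  by move=> c; rewrite !expnS expn0 muln1 !mulnA.
by ptime_auto.
Qed.

Theorem theorem1p2 :
  exists (q : nat -> nat) (M : nat -> field_model)
    (E : forall n : nat, n.-tuple (model_field (M n)) ->
                         (n + 3).-tuple (model_field (M n)))
    (D : forall n : nat, seq (model_field (M n)) ->
                         n.-tuple (model_field (M n))),
    (forall n : nat, 1 <= n ->
      [/\ (exists m : nat, q n = 2 ^ m) /\ q n < (n + 2) ^ 4,
          #|model_field (M n)| = q n,
          literal_systematic (E n),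
          corrects_burst2 (E n)
        & decodes_burst2 (E n) (D n)])
    /\ uniform_poly_time E D.
Proof.
exists (fun n => 2 ^ degree n), adj_model, adj_encode, adj_decode; split.
  move=> n n_gt0; have rn := room_degree n_gt0; have szM := size_adj_modulus n.
  have szx (x : n.-tuple (model_field (adj_model n))) : size x = n := size_tuple x.
  split; [|exact: card_adj_model| | |].
  - by split; [exists (degree n)|case/andP: (degree_bounds n)].
  - have szp (x : n.-tuple (model_field (adj_model n))) :
        size (drop n (adj_encode x)) == 3.
      by rewrite size_drop size_tuple addKn.
    exists (fun x => Tuple (szp x)) => x /=.
    rewrite -{1}(cat_take_drop n (elt_encode _ _)).
    by rewrite /elt_encode (take_encode _ _ _ _ (szx x)).
  - split.
      move=> x x' eqE; apply: val_inj.
      have /= := congr1 (fun t => take n (tval t)) eqE.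
      by rewrite /elt_encode !take_encode ?size_tuple.
    move=> r r2 c c' [x ->] [x' ->] neq w [].
    move=> /burst_descendantP[u [t [v [szt eE ->]]]].
    move=> /burst_descendantP[u' [t' [v' [szt' eE' eqw]]]].
    case: neq; congr (tval (adj_encode _)); apply: val_inj.
    apply: (elt_encode_burst szM rn (szx x) (szx x') _ _ eE eE' eqw); rewrite ?szt //.
  move=> b b2 x y yP; apply: val_inj; apply: (inj_map (elt_bits_inj szM)).
  rewrite adj_decodeE.
    exact: (decode_words_encode szM rn b2 (szx x) yP).
  have [u [t [v [szt eE ->]]]] := burst_descendantP yP.
  have := congr1 size eE; rewrite size_tuple !size_cat szt.
  by move: (size u) (size v) => i j; lia.
have [Pm [km run_m]] := ptime_modulus_word (ptime_degree_words ptime_id).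
have [Pe [ke run_e]] : ptime (fun p : nat * seq (seq bool) =>
    encode_words (all_words (degree p.1)) p.2).
  apply: ptime_encode_words; last exact: (ptime_snd ptime_id).
  exact: (ptime_degree_words (ptime_fst ptime_id)).
have [Pd [kd run_d]] : ptime (fun p : nat * seq (seq bool) =>
    decode_words (all_words (degree p.1)) p.1 p.2).
  apply: ptime_decode_words; [|exact: (ptime_fst ptime_id)|exact: (ptime_snd ptime_id)].
  exact: (ptime_degree_words (ptime_fst ptime_id)).
(* One exponent dominates those of the three programs, and 8 is the price of passing from tree sizes
   to [n + degree n]. *)
exists Pm, Pe, Pd, 1, (8 * (km + ke + kd)) => n n_gt0 T.
have szM := size_adj_modulus n; have d_gt0 := degree_gt0 n.
have TE : T = (n + degree n) ^ (8 * (km + ke + kd)).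
  by rewrite /T mul1n card_adj_model trunc_expnK.
have le_T k : k <= km + ke + kd -> (n + degree n) ^ (8 * k) <= T.
  by move=> le_k; rewrite TE leq_pexp2l ?leq_mul2l //; lia.
have bitsW (s : seq (model_field (adj_model n))) :
    all (fun w => size w == degree n) (map (elt_bits (degree n)) s).
  by apply/allP => w /mapP[a _ ->]; rewrite size_elt_bits.
split.
- rewrite enc_adj_model; apply: runs_within_le (run_m n) _.
  apply: leq_trans (le_T km _); last by lia.
  apply: leq_trans (input_size_le km n_gt0 d_gt0 (leq0n _ : size [::] <= _) isT).
  by apply: leq_exp2r_homo; rewrite esize_pair; lia.
- move=> x; rewrite !(enc_wordE szM) /= -(encode_words_bits szM).
  apply: runs_within_le (run_e (n, map (elt_bits (degree n)) x)) _.
  apply: leq_trans (le_T ke _); last by lia.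
  by apply: input_size_le => //; rewrite size_map size_tuple leq_addr.
move=> y szy; rewrite !(enc_wordE szM) adj_decodeE; last by move: szy; lia.
apply: runs_within_le (run_d (n, map (elt_bits (degree n)) y)) _.
apply: leq_trans (le_T kd _); last by lia.
by apply: input_size_le => //; rewrite size_map; case/andP: szy.
Qed.
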